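(* Let $(\mathcal{X}_1,Q_1,\pi_1)$ and $(\mathcal{X}_2,Q_2,\pi_2)$ be Markov triples, and let $(\mathcal{X},Q,\pi)$ be the Markov triple obtained by gluing the triples at $x_1\in\mathcal{X}_1$ and $x_2\in\mathcal{X}_2$. Let $\Lambda$ be an admissible mean and $\mathcal{W}$ the associated discrete transport distance on $\mathcal{P}(\mathcal{X})$. If $(\mu_t)_{t\in[0,1]}$ is a geodesic in $(\mathcal{P}(\mathcal{X}),\mathcal{W})$ with $\operatorname{supp}\mu_0,\operatorname{supp}\mu_1\subseteq\mathcal{X}_1$, then $\operatorname{supp}\mu_t\subseteq\mathcal{X}_1$ for all $t\in[0,1]$. (Here $\mathcal{X}_1$ is identified with its image in $\mathcal{X}$.)
   Context: Markov triple: $\mathcal{X}$ is a finite set; $Q:\mathcal{X}\times\mathcal{X}\to\mathbb{R}_+=[0,\infty)$ are transition rates with $Q(x,x)=0$; $Q$ is irreducible (any $x,y\in\mathcal{X}$ are connected by a path $x=x_0,\dots,x_n=y$ with $Q(x_{i-1},x_i)>0$); $\pi$ is the unique (strictly positive) stationary probability measure; and $Q$ is reversible: $\pi(x)Q(x,y)=\pi(y)Q(y,x)$ for all $x,y$. $\mathcal{P}(\mathcal{X})$ is the set of probability measures on $\mathcal{X}$. Gluing: given Markov triples $(\mathcal{X}_i,Q_i,\pi_i)$ and points $x_i\in\mathcal{X}_i$ ($i=1,2$), put $\mathcal{X}=(\mathcal{X}_1\sqcup\mathcal{X}_2)/\{x_1,x_2\}$ (the points $x_1$ and $x_2$ are identified),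 $\ast=[x_1]=[x_2]$, and $\mathcal{X}_i'=\mathcal{X}_i\setminus\{x_i\}$, regarded as a subset of $\mathcal{X}$. The rates are $Q(x,y)=Q_i(x,y)$ if $x,y\in\mathcal{X}_i'$; $Q(x,\ast)=Q_i(x,x_i)$ if $x\in\mathcal{X}_i'$; $Q(\ast,y)=Q_i(x_i,y)$ if $y\in\mathcal{X}_i'$; $Q=0$ otherwise. This $Q$ is irreducible and reversible with respect to its unique stationary probability measure $\pi$, which equals $\frac{1}{1-\pi_1(\mathcal{X}_1')\pi_2(\mathcal{X}_2')}$ times: $\pi_1(x)\pi_2(x_2)$ for $x\in\mathcal{X}_1'$, $\pi_1(x_1)\pi_2(x)$ for $x\in\mathcal{X}_2'$, and $\pi_1(x_1)\pi_2(x_2)$ for $x=\ast$. The image of $\mathcal{X}_i$ in $\mathcal{X}$ is $\mathcal{X}_i'\cup\{\ast\}$. Admissible mean: a continuous function $\Lambda:\mathbb{R}_+\times\mathbb{R}_+\to\mathbb{R}_+$ that is $C^\infty$ on $(0,\infty)^2$, symmetric, positively $1$-homogeneous, non-decreasing in each variable, jointly concave, with $\Lambda(1,1)=1$. Action: let $A:\mathbb{R}^3\to[0,\infty]$, $A(s,t,w)=w^2/\Lambda(s,t)$ if $w\in\mathbb{R}$ and $s,t>0$; $A(s,t,w)=0$ if $w=0$ and $s,t\ge0$; $A(s,t,w)=+\infty$ otherwise. For $\mu\in\mathcal{P}(\mathcal{X})$, $V:\mathcal{X}\times\mathcal{X}\to\mathbb{R}$ put $\mathcal{A}(\mu,V)=\frac12\sum_{x,y\in\mathcal{X}}A(\mu(x)Q(x,y),\mu(y)Q(y,x),V(x,y))$.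 Continuity equation: $\mathsf{CE}_1(\mu_0,\mu_1)$ is the set of pairs $(\mu,V)$ with $\mu:[0,1]\to\mathcal{P}(\mathcal{X})$ continuous, $V:[0,1]\to\mathbb{R}^{\mathcal{X}\times\mathcal{X}}$ locally integrable, $\mu|_{t=0}=\mu_0$, $\mu|_{t=1}=\mu_1$, and, in the sense of distributions, $\frac{d}{dt}\mu_t(x)+\frac12\sum_{y\in\mathcal{X}}(V_t(x,y)-V_t(y,x))=0$ for all $x\in\mathcal{X}$. Discrete transport distance: $\mathcal{W}(\mu_0,\mu_1)=\inf\big\{\sqrt{\int_0^1\mathcal{A}(\mu_t,V_t)\,dt}:(\mu,V)\in\mathsf{CE}_1(\mu_0,\mu_1)\big\}$. A geodesic in $(\mathcal{P}(\mathcal{X}),\mathcal{W})$ is a constant speed geodesic: a curve $(\mu_t)_{t\in[0,1]}$ in $\mathcal{P}(\mathcal{X})$ with $\mathcal{W}(\mu_s,\mu_t)=|t-s|\,\mathcal{W}(\mu_0,\mu_1)$ for all $s,t\in[0,1]$. *)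

(* Defs.v *)
From HB Require Import structures.
From mathcomp Require Import all_boot all_order all_algebra.
From mathcomp Require Import ring lra.
From mathcomp Require Import all_classical all_reals all_analysis.

Set Implicit Arguments.
Unset Strict Implicit.
Unset Printing Implicit Defensive.

Import Order.TTheory GRing.Theory Num.Theory.
Import numFieldNormedType.Exports.

Local Open Scope classical_set_scope.
Local Open Scope ring_scope.

Record fprob (R : realType) (X : finType) := Fprob {
  pmf :> X -> R;
  pmf_axiom : [forall x, 0 <= pmf x] && (\sum_x pmf x == 1) }.

Lemma pmf_ge0 (R : realType) (X : finType) (mu : fprob R X) x : 0 <= mu x.
Proof. by case/andP: (pmf_axiom mu) => /forallP. Qed.

Lemma pmf_sum1 (R : realType) (X : finType) (mu : fprob R X) :
  \sum_x mu x = 1.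
Proof. by case/andP: (pmf_axiom mu) => _ /eqP. Qed.

Lemma fprob_ext (R : realType) (X : finType) (mu nu : fprob R X) :
  mu =1 nu -> mu = nu.
Proof.
case: mu nu => [f pf] [g pg] /= /funext fg.
by case: _ / fg pg => pg; congr Fprob; exact: bool_irrelevance.
Qed.

Definition stationary (R : realType) (X : finType) (Q : X -> X -> R)
    (pi : X -> R) : Prop :=
  forall y, \sum_x pi x * Q x y = pi y * \sum_x Q y x.

Record markov_triple (R : realType) := MarkovTriple {
  state :> finType;
  rate : state -> state -> R;
  stat : fprob R state;
  rate_ge0 : forall x y, 0 <= rate x y;
  rate_diag : forall x, rate x x = 0;
  rate_irreducible : forall x y, connect (fun x y => 0 < rate x y) x y;
  stat_stationary : stationary rate stat;
  stat_reversible : forall x y, stat x * rate x y = stat y * rate y x }.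

Lemma stat_gt0 (R : realType) (M : markov_triple R) (x : M) : 0 < stat M x.
Proof.
have [z z0] : exists z, 0 < stat M z.
  apply/existsP; apply: contraT => /existsPn h.
  have /eqP := pmf_sum1 (stat M); rewrite big1 ?(eq_sym 0) ?oner_eq0// => i _.
  by apply/eqP; rewrite eq_le pmf_ge0 andbT leNgt.
have /connectP[p + ->] := rate_irreducible z x.
elim: p z z0 => //= y p IH z z0 /andP[zy]; apply: IH.
have := mulr_gt0 z0 zy; rewrite stat_reversible lt_neqAle => /andP[+ _].
by rewrite eq_sym mulf_eq0 negb_or lt_neqAle pmf_ge0 andbT eq_sym => /andP[].
Qed.

Lemma stat_unique (R : realType) (M : markov_triple R) (sigma : fprob R M) :
  stationary (@rate R M) sigma -> sigma = stat M.
Proof.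
move=> st; pose h x := sigma x / stat M x.
have hE x : sigma x = stat M x * h x.
  by rewrite /h mulrCA mulfV ?mulr1// gt_eqF// stat_gt0.
have harm y : \sum_x rate y x * (h y - h x) = 0.
  apply: (mulfI (lt0r_neq0 (stat_gt0 y))); rewrite mulr0 mulr_sumr.
  rewrite (eq_bigr (fun x => sigma y * rate y x - sigma x * rate x y)).
    by rewrite sumrB st mulr_sumr subrr.
  move=> x _; rewrite mulrA mulrBr; congr (_ - _).
    by rewrite mulrAC -hE.
  by rewrite stat_reversible mulrAC -hE.
have [z _] : exists z : M, true.
  case: (pickP (fun _ : M => true)) => [z _|M0]; first by exists z.
  by have /eqP := pmf_sum1 (stat M); rewrite big_pred0 // eq_sym oner_eq0.
pose y0 := [arg max_(y > z) h y]%O.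
have y0max x : h x <= h y0.
  by rewrite /y0; case: (@arg_maxP _ _ _ z xpredT h) => // y _; apply.
have hconst x : h x = h y0.
  have /connectP[p + ->] := rate_irreducible y0 x.
  have : h y0 = h y0 by [].
  elim: p {1 3 4}y0 => //= a p IH y hy /andP[ya]; apply: IH.
  have /eqP := harm y; rewrite psumr_eq0; last first.
    by move=> i _; rewrite mulr_ge0 ?rate_ge0// subr_ge0 hy y0max.
  move=> /allP /(_ a (mem_index_enum a)) /=.
  by rewrite mulf_eq0 (gt_eqF ya) /= subr_eq0 hy eq_sym => /eqP.
have h1 : h y0 = 1.
  rewrite -[LHS]mul1r -{1}(pmf_sum1 (stat M)) mulr_suml -(pmf_sum1 sigma).
  by apply: eq_bigr => x _; rewrite hE hconst.
by apply: fprob_ext => x; rewrite hE hconst h1 mulr1.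
Qed.

Section gluing.
Context {R : realType} (M1 M2 : markov_triple R) (x1 : M1) (x2 : M2).

(* [None] is the common point * of the quotient of the disjoint union of M1 and
   M2 by x1 ~ x2; the two subtypes are the complements of x1 and x2. *)
Definition glue_state : finType :=
  option ({x : M1 | x != x1} + {x : M2 | x != x2})%type.

Definition glue_in1 (x : M1) : glue_state := omap inl (insub x).
Definition glue_in2 (x : M2) : glue_state := omap inr (insub x).

Definition glue_rate (a b : glue_state) : R :=
  match a, b with
  | Some (inl x), Some (inl y) => rate (val x) (val y)
  | Some (inr x), Some (inr y) => rate (val x) (val y)
  | Some (inl x), None => rate (val x) x1
  | Some (inr x), None => rate (val x) x2
  | None, Some (inl y) => rate x1 (val y)
  | None, Some (inr y) => rate x2 (val y)
  | _, _ => 0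
  end.

Definition glue_pmf (a : glue_state) : R :=
  (1 - (\sum_(x | x != x1) stat M1 x) * (\sum_(x | x != x2) stat M2 x))^-1 *
  match a with
  | Some (inl x) => stat M1 (val x) * stat M2 x2
  | Some (inr x) => stat M1 x1 * stat M2 (val x)
  | None => stat M1 x1 * stat M2 x2
  end.

Lemma glue_in1_base : glue_in1 x1 = None.
Proof. by rewrite /glue_in1 insubF ?eqxx. Qed.

Lemma glue_in2_base : glue_in2 x2 = None.
Proof. by rewrite /glue_in2 insubF ?eqxx. Qed.

Lemma glue_in1_inj : injective glue_in1.
Proof.
move=> x y; rewrite /glue_in1.
case: insubP => [u _ <-|/negbNE/eqP->];
  by case: insubP => [v _ <-|/negbNE/eqP->] // [->].
Qed.

Lemma glue_in2_inj : injective glue_in2.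
Proof.
move=> x y; rewrite /glue_in2.
case: insubP => [u _ <-|/negbNE/eqP->];
  by case: insubP => [v _ <-|/negbNE/eqP->] // [->].
Qed.

Lemma glue_in12 x y : glue_in1 x = glue_in2 y -> x = x1 /\ y = x2.
Proof.
rewrite /glue_in1 /glue_in2; case: insubP => [u _ _|/negbNE/eqP->];
  by case: insubP => [v _ _|/negbNE/eqP->].
Qed.

Lemma glue_in_cover a :
  (exists x, a = glue_in1 x) \/ (exists y, a = glue_in2 y).
Proof.
case: a => [[u|v]|].
- by left; exists (val u); rewrite /glue_in1 valK.
- by right; exists (val v); rewrite /glue_in2 valK.
- by left; exists x1; rewrite glue_in1_base.
Qed.

Lemma glue_rate_in1 x y : glue_rate (glue_in1 x) (glue_in1 y) = rate x y.
Proof.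
rewrite /glue_in1; case: insubP => [u _ <-|/negbNE/eqP->];
  by case: insubP => [v _ <-|/negbNE/eqP->] //=; rewrite rate_diag.
Qed.

Lemma glue_rate_in2 x y : glue_rate (glue_in2 x) (glue_in2 y) = rate x y.
Proof.
rewrite /glue_in2; case: insubP => [u _ <-|/negbNE/eqP->];
  by case: insubP => [v _ <-|/negbNE/eqP->] //=; rewrite rate_diag.
Qed.

Lemma glue_rate_ge0 a b : 0 <= glue_rate a b.
Proof. by case: a b => [[a|a]|] [[b|b]|] //=; rewrite rate_ge0. Qed.

Lemma glue_rate_diag a : glue_rate a a = 0.
Proof. by case: a => [[a|a]|] //=; rewrite rate_diag. Qed.

Lemma glue_rate_irreducible a b :
  connect (fun a b => 0 < glue_rate a b) a b.
Proof.
have c1 x y : connect (fun a b => 0 < glue_rate a b) (glue_in1 x) (glue_in1 y).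
  have /connectP[p + ->] := rate_irreducible x y.
  elim: p x => //= z p IH x /andP[xz /IH]; apply/connect_trans/connect1.
  by rewrite glue_rate_in1.
have c2 x y : connect (fun a b => 0 < glue_rate a b) (glue_in2 x) (glue_in2 y).
  have /connectP[p + ->] := rate_irreducible x y.
  elim: p x => //= z p IH x /andP[xz /IH]; apply/connect_trans/connect1.
  by rewrite glue_rate_in2.
have c x y : connect (fun a b => 0 < glue_rate a b) (glue_in1 x) (glue_in2 y).
  by apply: connect_trans (c1 x x1) _; rewrite glue_in1_base -glue_in2_base.
have c' x y : connect (fun a b => 0 < glue_rate a b) (glue_in2 x) (glue_in1 y).
  by apply: connect_trans (c2 x x2) _; rewrite glue_in2_base -glue_in1_base.
by case: (glue_in_cover a) => [[x ->]|[x ->]];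
  case: (glue_in_cover b) => [[y ->]|[y ->]].
Qed.

Lemma stat_compl (M : markov_triple R) (x0 : M) :
  \sum_(x | x != x0) stat M x = 1 - stat M x0.
Proof. by rewrite -(pmf_sum1 (stat M)) [X in _ = X - _](bigD1 x0)//= addrAC subrr add0r. Qed.

Lemma glue_den_gt0 :
  0 < 1 - (\sum_(x | x != x1) stat M1 x) * (\sum_(x | x != x2) stat M2 x).
Proof.
rewrite !stat_compl.
have := stat_gt0 x1; have := stat_gt0 x2.
have : 0 <= 1 - stat M1 x1 by rewrite -stat_compl sumr_ge0// => *; exact: pmf_ge0.
move: (stat M1 x1) (stat M2 x2) => a b; nra.
Qed.

Lemma sum_sub_compl (T : finType) (x0 : T) (F : T -> R) :
  \sum_(u : {x : T | x != x0}) F (val u) = \sum_(x | x != x0) F x.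
Proof.
rewrite [RHS](reindex_omap (val : {x : T | x != x0} -> T) insub) => [|x x0x].
  by apply: eq_bigl => -[x x0x]; rewrite /= insubT x0x /= eqxx.
by rewrite insubT.
Qed.

Lemma sum_glue_state (F : glue_state -> R) :
  \sum_a F a = F None + (\sum_u F (Some (inl u)) + \sum_v F (Some (inr v))).
Proof.
rewrite (bigD1 None)//=; congr (_ + _).
rewrite (reindex_omap Some id) => [|[]//].
rewrite -(big_sumType _ xpredT (fun u => F (Some u))).
by apply: eq_bigl => u; rewrite /= eqxx.
Qed.

Lemma glue_pmf_axiom : [forall a, 0 <= glue_pmf a] && (\sum_a glue_pmf a == 1).
Proof.
apply/andP; split.
  apply/forallP => a; rewrite /glue_pmf mulr_ge0 ?invr_ge0 ?(ltW glue_den_gt0)//.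
  by case: a => [[a|a]|]; rewrite mulr_ge0 ?pmf_ge0.
rewrite /glue_pmf -mulr_sumr sum_glue_state -mulr_suml -mulr_sumr.
rewrite (sum_sub_compl x1 (stat M1)) (sum_sub_compl x2 (stat M2)).
have := glue_den_gt0; rewrite !stat_compl => d0.
apply/eqP; apply: (mulfI (lt0r_neq0 d0)).
rewrite mulrA mulfV ?lt0r_neq0//; ring.
Qed.

Definition glue_stat : fprob R glue_state := Fprob glue_pmf_axiom.

Lemma glue_reversible a b :
  glue_stat a * glue_rate a b = glue_stat b * glue_rate b a.
Proof.
rewrite /= /glue_pmf -!mulrA; congr (_ * _).
case: a b => [[a|a]|] [[b|b]|] //=; rewrite ?mulr0// -?mulrA.
- by rewrite mulrCA stat_reversible; ring.
- by rewrite mulrCA stat_reversible; ring.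
- by rewrite stat_reversible.
- by rewrite stat_reversible.
- by rewrite mulrCA stat_reversible; ring.
- by rewrite stat_reversible.
Qed.

Lemma glue_stationary : stationary glue_rate glue_stat.
Proof.
by move=> b; rewrite mulr_sumr; apply: eq_bigr => a _; exact: glue_reversible.
Qed.

Definition glued_triple : markov_triple R :=
  MarkovTriple glue_rate_ge0 glue_rate_diag glue_rate_irreducible
    glue_stationary glue_reversible.

End gluing.

(* C^oo on an open subset of a finite-dimensional space: the iterated directional
   derivatives of all orders and in all directions exist and are continuous. *)
Definition smooth_on (R : realType) (V : normedModType R) (U : set V)
    (f : V -> R) : Prop :=
  forall (vs : seq V) (p : V), U p ->
    let g := foldr (fun v h => 'D_v h) f vs in
    {for p, continuous g} /\ (forall v, derivable g p v).

(* The mean is a total function on R * R; only its values on the closed positive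
   quadrant matter. *)
Record admissible_mean (R : realType) (L : R * R -> R) : Prop := AdmissibleMean {
  mean_ge0 : forall s t : R, 0 <= s -> 0 <= t -> 0 <= L (s, t);
  mean_continuous :
    {within [set p : R * R | 0 <= p.1 /\ 0 <= p.2], continuous L};
  mean_smooth : smooth_on [set p : R * R | 0 < p.1 /\ 0 < p.2] L;
  mean_sym : forall s t : R, 0 <= s -> 0 <= t -> L (s, t) = L (t, s);
  mean_homogeneous : forall c s t : R, 0 < c -> 0 <= s -> 0 <= t ->
    L (c * s, c * t) = c * L (s, t);
  mean_nondecreasing1 : forall s s' t : R, 0 <= s -> s <= s' -> 0 <= t ->
    L (s, t) <= L (s', t);
  mean_nondecreasing2 : forall s t t' : R, 0 <= s -> 0 <= t -> t <= t' ->
    L (s, t) <= L (s, t');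
  mean_concave : forall c s t s' t' : R, 0 <= c <= 1 ->
    0 <= s -> 0 <= t -> 0 <= s' -> 0 <= t' ->
    c * L (s, t) + (1 - c) * L (s', t') <=
    L (c * s + (1 - c) * s', c * t + (1 - c) * t');
  mean_11 : L (1, 1) = 1 }.

Section transport.
Context {R : realType} (L : R * R -> R) (M : markov_triple R).
Implicit Types (mu : R -> fprob R M) (V : R -> M -> M -> R).

Definition action_density (s t w : R) : \bar R :=
  if (0 < s) && (0 < t) then (w ^+ 2 / L (s, t))%:E
  else if [&& w == 0, 0 <= s & 0 <= t] then 0%E
  else +oo%E.

Definition action (nu : fprob R M) (W : M -> M -> R) : \bar R :=
  (2^-1%:E * \sum_(x : M) \sum_(y : M)
    action_density (nu x * rate x y) (nu y * rate y x) (W x y))%E.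

Definition test_function (phi : R -> R) : Prop :=
  (forall n (t : R), derivable (derive1n n phi) t 1) /\
  closure [set t | phi t != 0] `<=` `]0, 1[.

(* Curves are total functions of time of which only the restriction to [0, 1]
   matters; on this compact interval, locally integrable means integrable. *)
Definition continuity_eq (mu0 mu1 : fprob R M) mu V : Prop :=
  [/\ forall x, {within `[0, 1], continuous (fun t : R => mu t x)},
      forall x y, lebesgue_measure.-integrable `[0, 1]
        (fun t : R => (V t x y)%:E),
      mu 0 = mu0, mu 1 = mu1 &
      forall x phi, test_function phi ->
        \int[lebesgue_measure]_(t in `[0, 1]) (derive1 phi t * mu t x) =
        \int[lebesgue_measure]_(t in `[0, 1])
          (phi t * (2^-1 * \sum_(y : M) (V t x y - V t y x)))].

Definition transport_dist (mu0 mu1 : fprob R M) : \bar R :=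
  ereal_inf
    [set sqrte (\int[lebesgue_measure]_(t in `[0%R, 1%R])
                  action (c.1 t) (c.2 t))%E
    | c in [set c | continuity_eq mu0 mu1 c.1 c.2]].

Definition geodesic mu : Prop :=
  forall s t : R, s \in `[0, 1] -> t \in `[0, 1] ->
    transport_dist (mu s) (mu t) =
    (`|t - s|%:E * transport_dist (mu 0%R) (mu 1%R))%E.

End transport.

(* Main.v *)
Require Import Defs.
From mathcomp Require Import all_boot all_order all_algebra.
From mathcomp Require Import ring lra.
From mathcomp Require Import all_classical all_reals all_analysis.
From mathcomp Require Import measurable_realfun.

Import Order.TTheory GRing.Theory Num.Theory.
Import numFieldNormedType.Exports.

Local Open Scope classical_set_scope.
Local Open Scope ring_scope.

(** Why geodesics stay in the first space. Let B be the part of the glued space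
    that comes from the second triple, without the common point *, and let p be
    the retraction that sends B to *. Given a curve of measures and fluxes
    solving the continuity equation, push both forward along p. The continuity
    equation survives, because it is linear and because the flux inside a fibre
    of p contributes nothing to the divergence. The action goes down: an edge
    between two states outside B keeps its flux while the masses at its ends
    can only grow, and the mean is monotone; an edge with an end in B no longer
    carries anything. The saving is quantitative. All the mass of B is brought
    there by the edges that disappear, the mean of the two ends of an edge is
    at most the largest rate, and so the Cauchy-Schwarz inequality, once over
    the edges and once over time, shows that a curve along which the mass of B
    changes by m saves at least a constant multiple of m ^ 2
    ([action_collapse], [energy_collapse]).

    Suppose now that a geodesic of length w between measures carried by the
    first space charges B at the time t, with mass m. Take nearly optimal curves
    from mu_0 to mu_t and from mu_t to mu_1, of energies close to (t w) ^ 2 and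
    ((1 - t) w) ^ 2, collapse them, and run the first one during the time t and
    the second one during the time 1 - t. The result joins mu_0 to mu_1, and
    its energy is close to w ^ 2 - k m ^ 2 (1 / t + 1 / (1 - t)), which is
    smaller than w ^ 2: a contradiction ([geodesic_avoids]).

    Two points need analysis. The continuity equation is tested against
    functions supported in the open interval only, whereas gluing two curves in
    time and computing the mass brought into B require the values at the ends
    of the interval; [weak_derivative_boundary] recovers the boundary terms with
    smooth cut-offs, built from the functions x ^- k * exp (- 1 / x). And the
    contradiction is one between real numbers: [finite_energy] joins any two
    measures by a curve of finite energy, so w is finite. *)

Set Implicit Arguments.
Unset Strict Implicit.
Unset Printing Implicit Defensive.

(** * Smooth functions and a smooth step *)

Section smooth_functions.
Context {R : realType}.
Implicit Types (f g phi : R -> R) (t : R).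

(** Recursion on the first derivative suits products and inverses, whose
    derivatives are again made of sums and products. *)
Fixpoint nderivable n f : Prop :=
  if n is m.+1 then (forall t : R, derivable f t 1) /\ nderivable m (derive1 f)
  else True.

Definition smooth f := forall n, nderivable n f.

Lemma derive1nSr n f : derive1n n.+1 f = derive1n n (derive1 f).
Proof. by rewrite /derive1n iterSr. Qed.

Lemma smooth_derivable_derive1n f :
  smooth f -> forall n t, derivable (derive1n n f) t 1.
Proof.
move=> sf n; have := sf n.+1; elim: n f {sf} => [|n IH] f; first by case.
by move=> [_ /IH]; rewrite derive1nSr.
Qed.

Lemma test_function_smooth phi : test_function phi -> smooth phi.
Proof.
move=> [dphi _] n; elim: n phi dphi => // n IH phi dphi; split.
  exact: (dphi 0%N).
by apply: IH => m t; rewrite -derive1nSr.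
Qed.

Lemma test_function_endpoints phi : test_function phi -> phi 0 = 0 /\ phi 1 = 0.
Proof.
case=> _ /(@subset_trans _ _ _ _ (@subset_closure _ _)) h.
by split; apply/eqP/negPn/negP => /h; rewrite /= in_itv /= ltxx ?andbF.
Qed.

Lemma smooth_derive1 f : smooth f -> smooth (derive1 f).
Proof. by move=> sf n; case: (sf n.+1). Qed.

Lemma smooth_derivable f t : smooth f -> derivable f t 1.
Proof. by move=> /(_ 1%N)[]. Qed.

Lemma smooth_is_derive f t : smooth f -> is_derive t 1 f (derive1 f t).
Proof. by move=> sf; rewrite derive1E; exact/derivableP/smooth_derivable. Qed.

Lemma smooth_continuous f : smooth f -> continuous f.
Proof.
by move=> sf t; apply/differentiable_continuous/derivable1_diffP/smooth_derivable.
Qed.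

Lemma nderivableW n f : nderivable n.+1 f -> nderivable n f.
Proof. by elim: n f => // n IH f [df /IH]. Qed.

Lemma nderivableS n f df :
  (forall t : R, is_derive t 1 f (df t)) -> nderivable n df -> nderivable n.+1 f.
Proof.
move=> fdf ndf; split=> [t|]; first by case: (fdf t).
suff -> : derive1 f = df by [].
by apply/funext => t; rewrite derive1E; case: (fdf t).
Qed.

Lemma nderivable_is_derive n f : nderivable n.+1 f ->
  (forall t : R, is_derive t 1 f (derive1 f t)) /\ nderivable n (derive1 f).
Proof. by move=> [df ndf]; split=> // t; rewrite derive1E; exact/derivableP. Qed.

Lemma nderivable_cst n (c : R) : nderivable n (cst c).
Proof. by elim: n c => // n IH c; exact: (nderivableS (df := cst 0)). Qed.

Lemma nderivableD n f g : nderivable n f -> nderivable n g -> nderivable n (f \+ g).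
Proof.
elim: n f g => // n IH f g /nderivable_is_derive[df nf] /nderivable_is_derive[dg ng].
by apply: nderivableS (IH _ _ nf ng) => t; exact: is_deriveD.
Qed.

Lemma nderivableM n f g : nderivable n f -> nderivable n g -> nderivable n (f \* g).
Proof.
elim: n f g => // n IH f g nf ng.
have [df nf'] := nderivable_is_derive nf; have [dg ng'] := nderivable_is_derive ng.
apply: nderivableS (nderivableD (IH _ _ (nderivableW nf) ng')
  (IH _ _ (nderivableW ng) nf')).
Qed.

Lemma is_derive_affine f (a b t df : R) : is_derive (a * t + b) 1 f df ->
  is_derive t 1 (fun u => f (a * u + b)) (a * df).
Proof.
move=> dfu; rewrite mulrC; apply: (@is_derive1_comp _ f (fun u => a * u + b)) dfu _.
have h : is_derive t 1 ((cst a * id) + cst b : R -> R) (a *: 1 + 0).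
  apply: is_deriveD; apply: (is_derive_eq (is_deriveM _ _)).
  by rewrite scaler0 addr0.
by apply: (is_derive_eq h); rewrite addr0 /GRing.scale /= mulr1.
Qed.

Lemma nderivable_affine n f (a b : R) :
  nderivable n f -> nderivable n (fun u => f (a * u + b)).
Proof.
elim: n f => // n IH f /nderivable_is_derive[df nf].
apply: nderivableS (nderivableM (nderivable_cst n a) (IH _ nf)).
by move=> t; exact: is_derive_affine.
Qed.

Lemma smooth_cst (c : R) : smooth (cst c).
Proof. by move=> n; exact: nderivable_cst. Qed.

Lemma smoothM f g : smooth f -> smooth g -> smooth (f \* g).
Proof. by move=> sf sg n; exact: nderivableM. Qed.

Lemma smooth_affine f (a b : R) : smooth f -> smooth (fun u => f (a * u + b)).
Proof. by move=> sf n; exact: nderivable_affine. Qed.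

Lemma derive1M f g t : smooth f -> smooth g ->
  derive1 (f \* g) t = derive1 f t * g t + f t * derive1 g t.
Proof.
move=> sf sg; have := is_deriveM (smooth_is_derive t sf) (smooth_is_derive t sg).
by move=> [_ h]; rewrite derive1E h addrC (mulrC _ (g t)).
Qed.

Lemma derive1_affine f (a b t : R) : smooth f ->
  derive1 (fun u => f (a * u + b)) t = a * derive1 f (a * t + b).
Proof.
move=> sf; have [_ h] := is_derive_affine (smooth_is_derive (a * t + b) sf).
by rewrite derive1E h.
Qed.

End smooth_functions.

Section bump_function.
Context {R : realType}.

(** The classical flat function is [flat 0]; the whole family is needed because
    it is closed under differentiation up to linear combinations, which gives
    smoothness by induction. *)
Definition flat k (x : R) : R := if 0 < x then x^-1 ^+ k * expR (- x^-1) else 0.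

Lemma flat_ge0 k x : 0 <= flat k x.
Proof.
rewrite /flat; case: ifPn => // x0.
by rewrite mulr_ge0 ?expR_ge0// exprn_ge0// invr_ge0 ltW.
Qed.

Lemma flat_gt0 k x : 0 < x -> 0 < flat k x.
Proof. by move=> x0; rewrite /flat x0 mulr_gt0 ?expR_gt0// exprn_gt0// invr_gt0. Qed.

Lemma flat_eq0 k x : x <= 0 -> flat k x = 0.
Proof. by move=> x0; rewrite /flat ltNge x0. Qed.

(** One term of the exponential series dominates every power; as the bound is
    linear for every [k], it also controls the difference quotient of
    [flat k] at 0, which is [flat k.+1]. *)
Lemma flat_le k x : flat k x <= k.+1`!%:R * `|x|.
Proof.
rewrite /flat; case: ifPn => [x0|_]; last by rewrite mulr_ge0.
rewrite gtr0_norm// expRN ler_pdivrMr ?expR_gt0//.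
have y0 : 0 < x^-1 by rewrite invr_gt0.
have := @expR_ge1Dxn R x^-1 k (ltW y0).
move=> /(le_trans (_ : x^-1 ^+ k.+1 / k.+1`!%:R <= _)).
move=> /(_ (ler_wpDl ler01 (lexx _))).
rewrite ler_pdivrMr ?ltr0n ?fact_gt0// => h.
rewrite -(ler_pM2l y0) -exprS (le_trans h)//.
rewrite (_ : x^-1 * _ = x^-1 * x * (expR x^-1 * k.+1`!%:R)); last by ring.
by rewrite mulVf ?mul1r// gt_eqF.
Qed.

Lemma is_derive_flat k (t : R) :
  is_derive t 1 (flat k) (flat k.+2 t - k%:R * flat k.+1 t).
Proof.
have [t0|t0|->] := ltgtP t 0.
- rewrite !flat_eq0 ?ltW// mulr0 subr0.
  apply: (@near_eq_is_derive _ _ _ (cst 0) (flat k)).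
  by near=> u; rewrite flat_eq0// ltW//; near: u; exact: lt_nbhsl.
- pose e : R -> R := (fun x => x^-1) ^+ k * (fun x => expR (- x^-1)).
  apply: (@near_eq_is_derive _ _ _ e (flat k)).
    by near=> u; rewrite /flat /e !fctE ifT//; near: u; exact: lt_nbhsr.
  have dV : is_derive t 1 (fun x : R => x^-1) (- t ^- 2).
    have := @is_deriveV R id t 1 1; rewrite gt_eqF// => /(_ erefl (is_derive_id _ _)).
    by move=> h; apply: (is_derive_eq h); rewrite /GRing.scale /= mulr1.
  have dE : is_derive t 1 (fun x : R => expR (- x^-1)) (expR (- t^-1) * t ^- 2).
    apply: (@is_derive1_comp _ expR (fun x => - x^-1)).
    rewrite -[X in is_derive _ _ _ X]opprK; exact: is_deriveN.
  have := is_deriveM (is_deriveX k dV) dE.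
  move=> h; apply: (is_derive_eq h).
  rewrite /flat t0 /GRing.scale /=.
  rewrite !fctE -!exprVn.
  case: k {e h} => [|k]; rewrite ?exprS /=; ring.
- rewrite !flat_eq0// mulr0 subr0.
  apply/is_derive1_caratheodory; exists (flat k.+1); split.
  + move=> z; rewrite subr0 [flat k 0]flat_eq0// subr0 /flat.
    case: ifPn => z0; last by rewrite mul0r.
    rewrite (_ : _ * z = z^-1 ^+ k * expR (- z^-1) * (z^-1 * z)); last first.
      by rewrite exprS; ring.
    by rewrite mulVf ?mulr1// gt_eqF.
  + change (flat k.+1 x @[x --> (0 : R)] --> flat k.+1 0); rewrite (@flat_eq0 k.+1 0)//.
    apply/norm_cvg0P; apply: (@squeeze_cvgr _ _ _ _ (cst 0) (fun x => k.+2`!%:R * `|x|)).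
    * by near=> x; rewrite normr_ge0 ger0_norm ?flat_ge0 ?flat_le.
    * exact: cvg_cst.
    * rewrite -[X in _ --> X](mulr0 (k.+2`!%:R)); apply: cvgM; first exact: cvg_cst.
      by rewrite -[X in _ --> X](@normr0 _ R); apply: cvg_norm; exact: cvg_id.
  + by rewrite flat_eq0.
Unshelve. all: by end_near. Qed.

Lemma smooth_flat k : smooth (flat k).
Proof.
move=> n; elim: n k => // n IH k.
apply: nderivableS (is_derive_flat k) _.
apply: (@nderivableD _ _ (flat k.+2) (fun t => - (k%:R * flat k.+1 t))) => //.
have -> : (fun t => - (k%:R * flat k.+1 t)) = cst (- k%:R) \* flat k.+1.
  by apply/funext => t /=; rewrite mulNr.
exact: nderivableM (nderivable_cst _ _) (IH _).
Qed.

End bump_function.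
Section smooth_step.
Context {R : realType}.
Implicit Types (f g : R -> R) (t x : R).

Lemma nderivableV n f : (forall t, f t != 0) ->
  nderivable n f -> nderivable n (fun t => (f t)^-1).
Proof.
move=> f0; elim: n => // n IH nf; have [df nf'] := nderivable_is_derive nf.
have h := nderivableM (IH (nderivableW nf)) (IH (nderivableW nf)).
apply: nderivableS (nderivableM (nderivable_cst n (-1)) (nderivableM h nf')) => t.
apply: (is_derive_eq (is_deriveV (f0 t) (df t))).
by rewrite /GRing.scale /= mulN1r mulNr -exprVn expr2.
Qed.

Definition step (x : R) : R := flat 0 x / (flat 0 x + flat 0 (1 - x)).

Lemma step_den_gt0 x : 0 < flat 0 x + flat 0 (1 - x).
Proof.
have [x0|x0] := ltP 0 x; first by rewrite ltr_pwDl ?flat_gt0 ?flat_ge0.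
by rewrite ltr_wpDl ?flat_ge0// flat_gt0// subr_gt0 (le_lt_trans x0).
Qed.

Lemma step_ge0 x : 0 <= step x.
Proof. by rewrite divr_ge0 ?flat_ge0 ?ltW ?step_den_gt0. Qed.

Lemma step_le1 x : step x <= 1.
Proof. by rewrite ler_pdivrMr ?step_den_gt0// mul1r lerDl flat_ge0. Qed.

Lemma step_eq0 x : x <= 0 -> step x = 0.
Proof. by move=> x0; rewrite /step flat_eq0// mul0r. Qed.

Lemma step_eq1 x : 1 <= x -> step x = 1.
Proof.
move=> x1; rewrite /step (@flat_eq0 _ 0 (1 - x)) ?subr_le0// addr0 divff//.
by rewrite gt_eqF// flat_gt0// (lt_le_trans ltr01).
Qed.

Lemma smooth_flat_rev k : smooth (fun x : R => flat k (1 - x)).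
Proof.
have -> : (fun x : R => flat k (1 - x)) = (fun x => flat k (-1 * x + 1)).
  by apply/funext => x; rewrite mulN1r addrC.
exact/smooth_affine/smooth_flat.
Qed.

Lemma smooth_step : smooth step.
Proof.
move=> n; apply: (@nderivableM _ _ (flat 0) (fun x => (flat 0 x + flat 0 (1 - x))^-1)).
  exact: smooth_flat.
apply: nderivableV => [t|]; first by rewrite gt_eqF ?step_den_gt0.
by apply: nderivableD; [exact: smooth_flat|exact: smooth_flat_rev].
Qed.

Lemma derive1_step x : derive1 step x =
  (flat 2 x * flat 0 (1 - x) + flat 0 x * flat 2 (1 - x)) /
  (flat 0 x + flat 0 (1 - x)) ^+ 2.
Proof.
have da := is_derive_flat 0 x; rewrite mul0r subr0 in da.
have db : is_derive x 1 (fun u : R => flat 0 (1 - u)) (- flat 2 (1 - x)).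
  have := is_derive_flat 0 (-1 * x + 1); rewrite mul0r subr0.
  move=> /is_derive_affine; rewrite mulN1r addrC mulN1r.
  by under eq_fun do rewrite mulN1r addrC.
pose den : R -> R := flat 0 + (fun u => flat 0 (1 - u)).
have dV := @is_deriveV _ den _ _ _ (lt0r_neq0 (step_den_gt0 x)) (is_deriveD da db).
have [_ h] := is_deriveM da dV.
rewrite derive1E h /den !fctE /GRing.scale /=; have := step_den_gt0 x.
move: (flat 0 x) (flat 0 (1 - x)) (flat 2 x) (flat 2 (1 - x)) => a b a' b' ab0.
by field; rewrite gt_eqF.
Qed.

(** The derivative of the step, suitably scaled, serves as an approximate
    identity. *)
Lemma derive1_step_ge0 x : 0 <= derive1 step x.
Proof.
rewrite derive1_step; apply: divr_ge0; last by rewrite exprn_ge0// ltW// step_den_gt0.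
by rewrite addr_ge0// mulr_ge0 ?flat_ge0.
Qed.

Lemma derive1_step_eq0 x : (x <= 0) || (1 <= x) -> derive1 step x = 0.
Proof.
rewrite derive1_step => /orP[x0|x1].
  by rewrite !(flat_eq0 _ x0) !mul0r addr0 mul0r.
have x1' : 1 - x <= 0 by rewrite subr_le0.
by rewrite !(flat_eq0 _ x1') !mulr0 addr0 mul0r.
Qed.

End smooth_step.

(** * Integration over the unit interval *)

Section unit_interval_integrals.
Context {R : realType}.
Local Notation lam := (@lebesgue_measure R).
Local Notation D := (`[0%R, 1%R]%classic : set R).
Implicit Types (f g F K phi : R -> R).

Lemma within_continuousM f g : {within D, continuous f} ->
  {within D, continuous g} -> {within D, continuous (f \* g)}.
Proof. by move=> cf cg x; apply: cvgM; [exact: cf|exact: cg]. Qed.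

Lemma smooth_within f : smooth f -> {within D, continuous f}.
Proof. by move=> /smooth_continuous; exact: continuous_subspaceT. Qed.

Lemma within_continuous_integrable f :
  {within D, continuous f} -> lam.-integrable D (EFin \o f).
Proof.
by move=> cf; apply: continuous_compact_integrable => //; exact: segment_compact.
Qed.

Lemma within_continuous_measurable f :
  {within D, continuous f} -> measurable_fun D f.
Proof. by move=> cf; exact: subspace_continuous_measurable_fun. Qed.

Lemma within_continuous_integrableM f g : {within D, continuous f} ->
  lam.-integrable D (EFin \o g) -> lam.-integrable D (EFin \o (f \* g)).
Proof.
move=> cf ig.
have := @integrableMr _ _ _ lam D _ f (EFin \o g) _ _ ig.
apply => //; first exact: within_continuous_measurable.
have /compact_bounded := continuous_compact cf (@segment_compact _ 0 1).
by move=> [M [rM h]]; exists M; split => // x Mx y Dy; apply: (h x Mx); exists y.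
Qed.

Lemma Rintegral01D f g : lam.-integrable D (EFin \o f) ->
  lam.-integrable D (EFin \o g) ->
  \int[lam]_(t in D) (f t + g t) = \int[lam]_(t in D) f t + \int[lam]_(t in D) g t.
Proof. by move=> *; exact: RintegralD. Qed.

Lemma Rintegral01B f g : lam.-integrable D (EFin \o f) ->
  lam.-integrable D (EFin \o g) ->
  \int[lam]_(t in D) (f t - g t) = \int[lam]_(t in D) f t - \int[lam]_(t in D) g t.
Proof. by move=> *; exact: RintegralB. Qed.

Lemma within_continuous_sum (I : Type) (s : seq I) (P : pred I) (f : I -> R -> R) :
  (forall i, {within D, continuous (f i)}) ->
  {within D, continuous (fun t => \sum_(i <- s | P i) f i t)}.
Proof.
move=> cf; elim: s => [|i s IH].
  rewrite (_ : (fun t => _) = cst 0); last by apply/funext => t; rewrite big_nil.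
  by move=> x; exact: cvg_cst.
rewrite (_ : (fun t => _) = (fun t => (if P i then f i t else 0) +
    \sum_(i <- s | P i) f i t)); last first.
  by apply/funext => t; rewrite big_cons; case: (P i) => //; rewrite add0r.
move=> x; apply: cvgD; last exact: IH.
by case: (P i); [exact: cf|exact: cvg_cst].
Qed.

Lemma integrable01_sum (I : Type) (s : seq I) (P : pred I) (f : I -> R -> R) :
  (forall i, lam.-integrable D (EFin \o f i)) ->
  lam.-integrable D (EFin \o (fun t => \sum_(i <- s | P i) f i t)).
Proof.
move=> jf; rewrite (_ : _ \o _ = (fun t => \sum_(i <- s | P i) (f i t)%:E)%E).
  by apply: integrable_sum => // i _; exact: jf.
by apply/funext => t /=; rewrite sumEFin.
Qed.

Lemma Rintegral01_sum (I : Type) (s : seq I) (P : pred I) (f : I -> R -> R) :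
  (forall i, lam.-integrable D (EFin \o f i)) ->
  \int[lam]_(t in D) (\sum_(i <- s | P i) f i t) =
  \sum_(i <- s | P i) \int[lam]_(t in D) f i t.
Proof.
move=> jf.
elim: s => [|i s IH].
  under eq_Rintegral do rewrite big_nil.
  by rewrite big_nil Rintegral_cst// mul0r.
rewrite big_cons; under eq_Rintegral do rewrite big_cons.
by case: (P i) => //; rewrite Rintegral01D ?IH//; exact: integrable01_sum.
Qed.

(** Jensen's inequality for the square, from [2 l |g| <= g ^ 2 + l ^ 2] with
    [l] the absolute value of the integral of [g]. The right-hand side may be
    infinite. *)
Lemma sqr_Rintegral_le (g : R -> R) : lam.-integrable D (EFin \o g) ->
  (((\int[lam]_(t in D) g t) ^+ 2)%:E <= \int[lam]_(t in `[0%R, 1%R]) (g t ^+ 2)%:E)%E.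
Proof.
have aux (l I r : R) : 0 <= l -> l <= I -> 2 * l * I <= r + l ^+ 2 -> l ^+ 2 <= r.
  move=> l0 lI h; have : 2 * l * l <= 2 * l * I by rewrite ler_wpM2l// mulr_ge0.
  by rewrite expr2 in h *; lra.
move=> jg; have mg : measurable_fun D g by case/integrableP : jg => /measurable_EFinP.
have mg2 : measurable_fun D (fun t => (g t ^+ 2)%:E).
  by apply/measurable_EFinP; exact: measurable_funX.
set l := `|\int[lam]_(t in D) g t|.
have le1 : l <= \int[lam]_(t in D) `|g t| by exact: le_normr_Rintegral.
rewrite -(real_normK (num_real (\int[lam]_(t in D) g t))) -/l.
have jn := integrable_norm jg.
have : (((2 * l) * \int[lam]_(t in D) `|g t|)%:E <=
    \int[lam]_(t in `[0%R, 1%R]) (g t ^+ 2)%:E + (l ^+ 2)%:E)%E.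
  rewrite -RintegralZl// /Rintegral fineK; last first.
    by apply: integrable_fin_num => //; exact: integrableZl jn.
  have -> : ((l ^+ 2)%:E = \int[lam]_(t in `[0%R, 1%R]) (l ^+ 2)%:E)%E.
    rewrite integral_cst//= lebesgue_measure_itv /= lte_fin ltr01 -EFinB subr0.
    by rewrite mule1.
  rewrite -ge0_integralD//; first last.
  - by move=> t _; rewrite lee_fin sqr_ge0.
  - by move=> t _; rewrite lee_fin sqr_ge0.
  apply: ge0_le_integral => //.
  - by move=> t _; rewrite lee_fin !mulr_ge0// normr_ge0.
  - by apply/measurable_EFinP; apply: measurable_funM => //; exact: measurableT_comp.
  - by apply: emeasurable_funD.
  - move=> t _; rewrite -EFinD lee_fin -(real_normK (num_real (g t))).
    by have := sqr_ge0 (`|g t| - l); rewrite sqrrB mulr2n; lra.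
have l0 : 0 <= l by exact: normr_ge0.
case: (\int[lam]_(t in _) (g t ^+ 2)%:E)%E => [r| |].
- by rewrite -EFinD !lee_fin; exact: aux.
- by move=> _; rewrite leey.
- by rewrite addNye leeNy_eq.
Qed.

Lemma Rintegral_cvg_indicator (chi : nat -> R -> R) g :
  lam.-integrable D (EFin \o g) ->
  (forall n, measurable_fun D (chi n)) ->
  (forall n x, 0 <= chi n x <= 1) ->
  (forall x, 0 < x < 1 -> chi n x @[n --> \oo] --> (1 : R)) ->
  \int[lam]_(t in D) (chi n t * g t) @[n --> \oo] --> \int[lam]_(t in D) g t.
Proof.
move=> ig mchi chi01 chi1.
have mg : measurable_fun D g by case/integrableP : ig => /measurable_EFinP.
have := @dominated_convergence _ _ R lam D _ (fun n t => (chi n t * g t)%:E)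
  (EFin \o g) (abse \o EFin \o g).
case=> //.
- move=> n; apply/measurable_EFinP. exact: (measurable_funM (mchi n) mg).
- exact/measurable_EFinP.
- exists ([set 0] `|` [set 1]); split.
  + exact: measurableU.
  + by rewrite null_set_setU//; exact: lebesgue_measure_set1.
  + move=> x /= /not_implyP[]; rewrite in_itv /= => /andP[].
    rewrite le_eqVlt => /predU1P[<-|x0]; first by left.
    rewrite le_eqVlt => /predU1P[->|x1]; first by right.
    case; apply: cvg_EFin; first by apply: nearW.
    rewrite -[X in _ --> X]mul1r; apply: cvgM; last exact: cvg_cst.
    by apply: chi1; rewrite x0.
- exact: integrable_abse.
- apply: aeW => x n _ /=; rewrite lee_fin normrM ler_piMl//.
  by have /andP[? ?] := chi01 n x; rewrite ger0_norm.
- move=> _ _ h; apply: fine_cvg; rewrite fineK//.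
  exact: integrable_fin_num.
Qed.

(** An approximate identity concentrating at [p], where [p] may be an end of
    the interval. *)
Lemma Rintegral_cvg_kernel (k : nat -> R -> R) K (p : R) N :
  {within D, continuous K} -> p \in `[0, 1] ->
  (forall n, {within D, continuous (k n)}) ->
  (forall n x, 0 <= k n x) ->
  (forall n, (N <= n)%N -> \int[lam]_(t in D) k n t = 1) ->
  (forall n x, k n x != 0 -> `|p - x| <= 2 / n%:R) ->
  \int[lam]_(t in D) (k n t * K t) @[n --> \oo] --> K p.
Proof.
move=> cK p01 ck k0 k1 kp; apply/cvgrPdist_le => e e0.
have Dp : D p by [].
have /subspace_continuousP/(_ _ Dp)/cvgrPdist_le/(_ e e0) := cK.
rewrite /within /= => -[d /= d0 hd].
near=> n.
have nN : (N <= n)%N by near: n; exists N.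
have nd : 2 / n%:R < d.
  rewrite ltr_pdivrMr ?ltr0n; last by near: n; exists 1%N.
  rewrite -ltr_pdivrMl// mulrC; near: n; exact: nbhs_infty_gtr.
have i1 : lam.-integrable D (EFin \o (k n)) by exact: within_continuous_integrable.
have i2 : lam.-integrable D (EFin \o (k n \* K)).
  by apply: within_continuous_integrable; exact: within_continuousM.
have cKp : {within D, continuous (fun t => k n t * (K p - K t))}.
  apply: within_continuousM => //.
  by move=> x; apply: cvgB; [exact: cvg_cst|exact: cK].
have kZ c : lam.-integrable D (EFin \o (fun t => k n t * c)).
  apply: within_continuous_integrable; apply: within_continuousM => // x.
  exact: cvg_cst.
have kE c : \int[lam]_(t in D) (k n t * c) = c by rewrite RintegralZr// k1// mul1r.
rewrite -{1}(kE (K p)) -RintegralB//.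
rewrite (_ : \int[lam]_(x in D) _ = \int[lam]_(t in D) (k n t * (K p - K t))); last first.
  by apply: eq_Rintegral => x _; rewrite mulrBr.
apply: (le_trans (le_normr_Rintegral _ (within_continuous_integrable cKp))) => //.
rewrite -[leRHS]kE; apply: le_Rintegral => //.
- exact: integrable_norm (within_continuous_integrable cKp).
- move=> x Dx; rewrite normrM ger0_norm//.
  have [->|kx] := eqVneq (k n x) 0; first by rewrite !mul0r.
  rewrite ler_wpM2l//; apply: hd => //=.
  exact: le_lt_trans (kp _ _ kx) nd.
Unshelve. all: by end_near. Qed.

End unit_interval_integrals.
(** * The continuity equation against all smooth functions *)

Section boundary_terms.
Context {R : realType}.
Local Notation lam := (@lebesgue_measure R).
Local Notation D := (`[0%R, 1%R]%classic : set R).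
Implicit Types (f g F phi : R -> R).

Lemma Rintegral_derive1 f : smooth f -> \int[lam]_(t in D) derive1 f t = f 1 - f 0.
Proof.
move=> sf; have cf := smooth_continuous sf.
have := @continuous_FTC2 _ (derive1 f) f 0 1 ltr01.
rewrite /Rintegral => ->//.
- exact: smooth_within (smooth_derive1 sf).
- split; first by move=> x _; exact: smooth_derivable.
  + exact: cvg_at_right_filter (cf 0).
  + exact: cvg_at_left_filter (cf 1).
Qed.

(** The product of the two cut-offs vanishes within [1 / n] of the ends of the
    unit interval and is 1 at distance at least [2 / n] from them; the kernels are the
    absolute values of their derivatives. *)
Definition left_cutoff (n : nat) (t : R) := step (n%:R * t + -1).
Definition right_cutoff (n : nat) (t : R) := step (- n%:R * t + (n%:R - 1)).
Definition left_kernel (n : nat) (t : R) : R :=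
  n%:R * derive1 step (n%:R * t + -1).
Definition right_kernel (n : nat) (t : R) : R :=
  n%:R * derive1 step (- n%:R * t + (n%:R - 1)).

Lemma smooth_left_cutoff n : smooth (left_cutoff n).
Proof. exact/smooth_affine/smooth_step. Qed.

Lemma smooth_right_cutoff n : smooth (right_cutoff n).
Proof. exact/smooth_affine/smooth_step. Qed.

Local Hint Resolve smooth_left_cutoff smooth_right_cutoff : core.

Lemma derive1_left_cutoff n t : derive1 (left_cutoff n) t = left_kernel n t.
Proof. exact: (@derive1_affine _ step _ _ _ smooth_step). Qed.

Lemma derive1_right_cutoff n t : derive1 (right_cutoff n) t = - right_kernel n t.
Proof. by rewrite (@derive1_affine _ step _ _ _ smooth_step) mulNr. Qed.

Lemma within_left_kernel n : {within D, continuous (left_kernel n)}.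
Proof.
have -> : left_kernel n = derive1 (left_cutoff n).
  by apply/funext => t; rewrite derive1_left_cutoff.
exact/smooth_within/smooth_derive1/smooth_left_cutoff.
Qed.

Lemma within_right_kernel n : {within D, continuous (right_kernel n)}.
Proof.
have -> : right_kernel n = (cst (-1)) \* derive1 (right_cutoff n).
  by apply/funext => t; rewrite /= derive1_right_cutoff mulN1r opprK.
apply: within_continuousM => [x|]; first exact: cvg_cst.
exact/smooth_within/smooth_derive1/smooth_right_cutoff.
Qed.

Local Hint Resolve within_left_kernel within_right_kernel : core.

Lemma left_kernel_neq0 n t : left_kernel n t != 0 -> 1 < n%:R * t < 2.
Proof.
rewrite /left_kernel mulf_eq0 negb_or => /andP[_]; apply: contraNT.
rewrite negb_and -!leNgt => h; rewrite derive1_step_eq0//.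
by rewrite lerBlDr add0r lerBrDr -[1 + 1]/2.
Qed.

Lemma right_kernel_neq0 n t :
  right_kernel n t != 0 -> n%:R - 2 < n%:R * t < n%:R - 1.
Proof.
rewrite /right_kernel mulf_eq0 negb_or => /andP[_]; apply: contraNT.
rewrite negb_and -!leNgt => /orP h; rewrite derive1_step_eq0//.
by apply/orP; case: h => h; [right|left]; lra.
Qed.

(** For [4 <= n] the layers where the two cut-offs vary are disjoint, so each
    kernel lives where the other cut-off is 1. *)
Lemma left_kernel_cutoff n t : (4 <= n)%N ->
  left_kernel n t * right_cutoff n t = left_kernel n t.
Proof.
rewrite -(ler_nat R) => n4.
have [->|/left_kernel_neq0/andP[_ nt]] := eqVneq (left_kernel n t) 0.
  by rewrite mul0r.
by rewrite /right_cutoff step_eq1 ?mulr1//; lra.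
Qed.

Lemma right_kernel_cutoff n t : (4 <= n)%N ->
  left_cutoff n t * right_kernel n t = right_kernel n t.
Proof.
rewrite -(ler_nat R) => n4.
have [->|/right_kernel_neq0/andP[nt _]] := eqVneq (right_kernel n t) 0.
  by rewrite mulr0.
by rewrite /left_cutoff step_eq1 ?mul1r//; lra.
Qed.

Lemma Rintegral_left_kernel n : (4 <= n)%N ->
  \int[lam]_(t in D) left_kernel n t = 1.
Proof.
rewrite -(ler_nat R) => n4; under eq_Rintegral do rewrite -derive1_left_cutoff.
rewrite Rintegral_derive1// /left_cutoff step_eq1; last by lra.
by rewrite step_eq0 ?subr0//; lra.
Qed.

Lemma Rintegral_right_kernel n : (4 <= n)%N ->
  \int[lam]_(t in D) right_kernel n t = 1.
Proof.
rewrite -(ler_nat R) => n4.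
under eq_Rintegral do rewrite -[right_kernel _ _]opprK -derive1_right_cutoff -mulN1r.
rewrite RintegralZl//; last first.
  exact/within_continuous_integrable/smooth_within/smooth_derive1/smooth_right_cutoff.
rewrite Rintegral_derive1// /right_cutoff step_eq0; last by lra.
by rewrite step_eq1; lra.
Qed.

Lemma test_function_cut n phi : (4 <= n)%N -> smooth phi ->
  test_function (phi \* (left_cutoff n \* right_cutoff n)).
Proof.
rewrite -(ler_nat R) => n4 sphi; split.
  apply: smooth_derivable_derive1n; apply: smoothM => //.
  exact: smoothM.
have n0 : 0 < n%:R :> R by lra.
have cl : closed (`[n%:R^-1, 1 - n%:R^-1]%classic : set R) by exact: interval_closed.
apply: (@subset_trans _ `[n%:R^-1, 1 - n%:R^-1]); last first.
  apply: subset_itv; rewrite bnd_simp ?invr_gt0//.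
  by rewrite ltrBlDr ltrDl invr_gt0.
rewrite (iffLR (closure_id _) cl); apply: closureS => t /=.
rewrite in_itv /= => h; apply/andP; split; rewrite leNgt; apply: contraNN h => h.
  rewrite /left_cutoff step_eq0 ?mul0r ?mulr0//.
  by rewrite subr_le0 mulrC -ler_pdivlMr// mul1r ltW.
rewrite /right_cutoff step_eq0 ?mulr0//.
move: h; rewrite ltrBlDr -(ltr_pM2l n0) mulrDr mulfV ?gt_eqF//; lra.
Qed.

Lemma cutoff01 n t : 0 <= left_cutoff n t * right_cutoff n t <= 1.
Proof.
by rewrite mulr_ge0 ?step_ge0//= mulr_ile1 ?step_ge0 ?step_le1.
Qed.

Lemma cutoff_cvg t : 0 < t < 1 ->
  left_cutoff n t * right_cutoff n t @[n --> \oo] --> (1 : R).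
Proof.
move=> /andP[t0 t1]; apply: (@cvg_near_cst _ _ (1 : R)).
near=> n.
have n1 : 2 / t < n%:R by near: n; exact: nbhs_infty_gtr.
have n2 : 2 / (1 - t) < n%:R by near: n; exact: nbhs_infty_gtr.
rewrite ltr_pdivrMr// in n1; rewrite ltr_pdivrMr ?subr_gt0// in n2.
by rewrite /left_cutoff /right_cutoff !step_eq1 ?mulr1//; lra.
Unshelve. all: by end_near. Qed.

(** Test the weak equation [F' = - g] with [phi] times the cut-offs. The
    derivative of the left cut-off is an approximate identity at 0 and produces
    [phi 0 * F 0] in the limit; the right one produces [- phi 1 * F 1]. The other
    terms converge by dominated convergence. *)
Lemma weak_derivative_boundary F g :
  {within D, continuous F} -> lam.-integrable D (EFin \o g) ->
  (forall phi, test_function phi ->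
    \int[lam]_(t in D) (derive1 phi t * F t) = \int[lam]_(t in D) (phi t * g t)) ->
  forall phi, smooth phi ->
    \int[lam]_(t in D) (derive1 phi t * F t) =
    phi 1 * F 1 - phi 0 * F 0 + \int[lam]_(t in D) (phi t * g t).
Proof.
move=> cF ig weak phi sphi.
have cphi := smooth_within sphi.
have cdphi := smooth_within (smooth_derive1 sphi).
have cphiF := within_continuousM cphi cF.
have cdphiF := within_continuousM cdphi cF.
have iphig := within_continuous_integrableM cphi ig.
have cchi n : {within D, continuous (left_cutoff n \* right_cutoff n)}.
  by apply: within_continuousM; exact: smooth_within.
have mchi n := within_continuous_measurable (cchi n).
have A := Rintegral_cvg_indicator (within_continuous_integrable cdphiF) mchi
  cutoff01 cutoff_cvg.
have E := Rintegral_cvg_indicator iphig mchi cutoff01 cutoff_cvg.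
have kl0 n x : 0 <= left_kernel n x by rewrite mulr_ge0// derive1_step_ge0.
have kr0 n x : 0 <= right_kernel n x by rewrite mulr_ge0// derive1_step_ge0.
have p0 : (0 : R) \in `[0, 1] by rewrite in_itv /= lexx ler01.
have p1 : (1 : R) \in `[0, 1] by rewrite in_itv /= lexx ler01.
have near0 n x : left_kernel n x != 0 -> `|0 - x| <= 2 / n%:R.
  move=> h; have /left_kernel_neq0/andP[h1 h2] := h.
  have n0 : 0 < n%:R :> R.
    by move: h; rewrite mulf_eq0 negb_or lt0r ler0n andbT => /andP[].
  have x0 : 0 < x by rewrite -(pmulr_rgt0 _ n0); lra.
  by rewrite sub0r normrN gtr0_norm// ler_pdivlMr// mulrC ltW.
have near1 n x : right_kernel n x != 0 -> `|1 - x| <= 2 / n%:R.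
  move=> h; have /right_kernel_neq0/andP[h1 h2] := h.
  have n0 : 0 < n%:R :> R.
    by move: h; rewrite mulf_eq0 negb_or lt0r ler0n andbT => /andP[].
  have x0 : 0 < 1 - x by rewrite -(pmulr_rgt0 _ n0) mulrBr; lra.
  by rewrite gtr0_norm// ler_pdivlMr// mulrBl mul1r mulrC; lra.
have B := Rintegral_cvg_kernel cphiF p0 within_left_kernel kl0
  Rintegral_left_kernel near0.
have C := Rintegral_cvg_kernel cphiF p1 within_right_kernel kr0
  Rintegral_right_kernel near1.
pose S n :=
  \int[lam]_(t in D) (left_cutoff n t * right_cutoff n t * (derive1 phi t * F t)) +
  \int[lam]_(t in D) (left_kernel n t * (phi t * F t)) -
  \int[lam]_(t in D) (right_kernel n t * (phi t * F t)).
have L : S n @[n --> \oo] --> \int[lam]_(t in D) (derive1 phi t * F t) +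
    phi 0 * F 0 - phi 1 * F 1.
  by apply: cvgB; [apply: cvgD; [exact: A|exact: B]|exact: C].
suff : \int[lam]_(t in D) (derive1 phi t * F t) + phi 0 * F 0 - phi 1 * F 1 =
  \int[lam]_(t in D) (phi t * g t) by move: (\int[lam]_(_ in D) _) => a; lra.
suff LE : S n @[n --> \oo] --> \int[lam]_(t in D) (phi t * g t).
  by rewrite -[LHS](cvg_lim (@Rhausdorff R) L) (cvg_lim (@Rhausdorff R) LE).
apply: cvg_trans E; apply: near_eq_cvg; near=> n.
have n4 : (4 <= n)%N by near: n; exists 4%N.
rewrite /S.
have iA : lam.-integrable D
    (EFin \o ((left_cutoff n \* right_cutoff n) \* (derive1 phi \* F))).
  by apply: within_continuous_integrable; exact: (within_continuousM (cchi n) cdphiF).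
have iB : lam.-integrable D (EFin \o (left_kernel n \* (phi \* F))).
  apply: within_continuous_integrable.
  exact: (within_continuousM (@within_left_kernel n) cphiF).
have iC : lam.-integrable D (EFin \o (right_kernel n \* (phi \* F))).
  apply: within_continuous_integrable.
  exact: (within_continuousM (@within_right_kernel n) cphiF).
have iAB : lam.-integrable D (EFin \o (fun t =>
    ((left_cutoff n \* right_cutoff n) \* (derive1 phi \* F)) t +
    (left_kernel n \* (phi \* F)) t)).
  have := integrableD _ iA iB; by apply.
have := weak _ (test_function_cut n4 sphi).
rewrite (_ : \int[lam]_(t in D) (_ * (phi t * g t)) =
  \int[lam]_(t in D) ((phi \* (left_cutoff n \* right_cutoff n)) t * g t)); last first.
  by apply: eq_Rintegral => t _; rewrite /= mulrA (mulrC _ (phi t)).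
move=> <-.
have dAB := Rintegral01D iA iB; have := Rintegral01B iAB iC.
rewrite dAB => {dAB} dABC; refine (etrans _ dABC).
apply: eq_Rintegral => t _.
have dphi := derive1M t sphi (smoothM (smooth_left_cutoff n) (smooth_right_cutoff n)).
rewrite dphi (derive1M t (smooth_left_cutoff n) (smooth_right_cutoff n)).
rewrite derive1_left_cutoff derive1_right_cutoff left_kernel_cutoff// mulrN.
rewrite right_kernel_cutoff//=.
have alg (a b c d e p q : R) :
  (a * (d * e) + b * (p - q)) * c = d * e * (a * c) + p * (b * c) - q * (b * c).
  by ring.
exact: alg.
Unshelve. all: by end_near. Qed.

End boundary_terms.
(** * Rescaling and concatenation in time *)

Section concatenation.
Context {R : realType}.
Local Notation lam := (@lebesgue_measure R).
Local Notation D := (`[0%R, 1%R]%classic : set R).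

Definition rescale (b k : R) (x : measurableTypeR R) : measurableTypeR R :=
  (x - b) / k.

Lemma measurable_rescale (b k : R) : measurable_fun setT (rescale b k).
Proof.
apply: measurable_realfun.continuous_measurable_fun => x.
apply: cvgM; last exact: cvg_cst.
by apply: cvgB; [exact: cvg_id|exact: cvg_cst].
Qed.

Lemma rescale_preimage_itv (b k x y : R) (c d : bool) : 0 < k ->
  rescale b k @^-1` [set` Interval (BSide c x) (BSide d y)] =
  [set` Interval (BSide c (b + k * x)) (BSide d (b + k * y))].
Proof.
move=> k0; apply/seteqP; split=> t;
  rewrite /= !in_itv /rescale /=; case: c d => -[] /=;
  rewrite ?ler_pdivlMr ?ltr_pdivlMr ?ler_pdivrMr ?ltr_pdivrMr//;
  by move=> /andP[? ?]; apply/andP; split; lra.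
Qed.

Lemma lebesgue_pushforward_rescale (b k : R) (k0 : 0 < k) (A : set R) :
  measurable A ->
  pushforward lam (rescale b k) A = mscale (NngNum (ltW k0)) lam A.
Proof.
move=> mA.
have ki0 : 0 <= k^-1 by rewrite invr_ge0 ltW.
have h B : ocitv B ->
    lam B = mscale (NngNum ki0) (pushforward lam (rescale b k)) B.
  move=> [[x y] _ <-]; rewrite -[LHS]/(lam `]x, y]%classic).
  transitivity (k^-1%:E * lam `](b + k * x)%R, (b + k * y)%R]%classic)%E; last first.
    by congr (_ * lam _)%E; rewrite -rescale_preimage_itv.
  rewrite !lebesgue_measure_itv /= !lte_fin.
  rewrite ltrD2l ltr_pM2l//; case: ifPn => _; last by rewrite mule0.
  rewrite -!EFinD -EFinM; congr EFin.
  rewrite (_ : b + k * y - (b + k * x) = k * (y - x)); last by ring.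
  by rewrite mulrA mulVf ?mul1r// gt_eqF.
have mr := @measurable_rescale b k.
rewrite /mscale /= [X in (_ * X)%E](lebesgue_measure_unique (h mr) mA) /mscale /=.
by rewrite muleA -EFinM divff ?gt_eqF// mul1e.
Qed.

Lemma ge0_integral_rescale (b : R) (k : R) (f : R -> \bar R) : 0 < k ->
  measurable_fun D f -> (forall x, x \in `[0, 1] -> (0 <= f x)%E) ->
  (\int[lam]_(x in `[b, (b + k)%R]) f ((x - b) / k)%R =
   k%:E * \int[lam]_(x in `[0%R, 1%R]) f x)%E.
Proof.
move=> k0 mf f0.
have -> : `[b, b + k]%classic = rescale b k @^-1` D.
  by rewrite rescale_preimage_itv// mulr0 addr0 mulr1.
rewrite -[RHS](@ge0_integral_mscale _ _ _ lam D _ (NngNum (ltW k0)) f)//.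
transitivity (\int[pushforward lam (rescale b k)]_(x in D) f x)%E.
  rewrite ge0_integral_pushforward//; first exact: measurable_rescale.
  by move=> x; rewrite inE; exact: f0.
apply: eq_measure_integral; first exact: measurable_rescale.
by move=> mr A mA _; exact: lebesgue_pushforward_rescale.
Qed.

(** Two curves over the unit interval, run one after the other: the first one
    during [[0, tau]], the second one during [[tau, 1]]. *)
Definition concat (tau : R) (T : Type) (f g : R -> T) (s : R) : T :=
  if s <= tau then f (s / tau) else g ((s - tau) / (1 - tau)).

Lemma concat_comp (tau : R) (T T' : Type) (h : T -> T') (f g : R -> T) s :
  h (concat tau f g s) = concat tau (h \o f) (h \o g) s.
Proof. by rewrite /concat; case: ifP. Qed.

Variables (tau : R) (tau01 : 0 < tau < 1).

Let tau0 : 0 < tau. Proof. by case/andP: tau01. Qed.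
Let tau1 : 0 < 1 - tau. Proof. by case/andP: tau01; rewrite subr_gt0. Qed.

Lemma concat_split : D = `[0, tau]%classic `|` `]tau, 1]%classic.
Proof.
apply/seteqP; split=> t; rewrite /= !in_itv /=.
  move=> /andP[t0 t1]; have [tt|tt] := leP t tau; first by left; rewrite t0.
  by right; rewrite t1.
by case=> /andP[? ?]; apply/andP; split; have := tau0; have := tau1; lra.
Qed.

Lemma concat_left (T : Type) (f g : R -> T) s : s \in `[0, tau] ->
  concat tau f g s = f ((s - 0) / tau).
Proof. by rewrite in_itv /= /concat subr0 => /andP[_ ->]. Qed.

Lemma concat_right (T : Type) (f g : R -> T) s : s \in `]tau, 1] ->
  concat tau f g s = g ((s - tau) / (1 - tau)).
Proof. by rewrite in_itv /= /concat => /andP[h _]; rewrite leNgt h. Qed.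

Lemma measurable_concat d (T : sigmaRingType d) (f g : R -> T) :
  measurable_fun D f -> measurable_fun D g -> measurable_fun D (concat tau f g).
Proof.
move=> mf mg; rewrite concat_split; apply/measurable_funU => //; split.
  apply: (@eq_measurable_fun _ _ _ _ _ (f \o rescale 0 tau)).
    by move=> s; rewrite inE => /concat_left ->.
  apply: (measurable_comp (F := D)) => //; last first.
    by apply: measurable_funTS; exact: measurable_rescale.
  move=> _ [s /= h <-]; move: h; rewrite !in_itv /rescale /= subr0.
  by rewrite ler_pdivlMr// mul0r ler_pdivrMr// mul1r.
apply: (@eq_measurable_fun _ _ _ _ _ (g \o rescale tau (1 - tau))).
  by move=> s; rewrite inE => /concat_right ->.
apply: (measurable_comp (F := D)) => //; last first.
  by apply: measurable_funTS; exact: measurable_rescale.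
move=> _ [s /= h <-]; move: h; rewrite !in_itv /rescale /=.
rewrite ler_pdivlMr// mul0r ler_pdivrMr// mul1r => /andP[? ?].
by apply/andP; split; lra.
Qed.

Lemma ge0_integral_concat (f g : R -> \bar R) :
  measurable_fun D f -> measurable_fun D g ->
  (forall x, x \in `[0, 1] -> (0 <= f x)%E) ->
  (forall x, x \in `[0, 1] -> (0 <= g x)%E) ->
  (\int[lam]_(x in `[0%R, 1%R]) concat tau f g x =
   tau%:E * \int[lam]_(x in `[0%R, 1%R]) f x +
   (1 - tau)%:E * \int[lam]_(x in `[0%R, 1%R]) g x)%E.
Proof.
move=> mf mg f0 g0; have mfg := measurable_concat mf mg.
rewrite [in LHS]concat_split ge0_integral_setU//=.
- congr (_ + _)%E.
    refine (etrans _ (ge0_integral_rescale 0 tau0 mf f0)); rewrite add0r.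
    by apply: eq_integral => s; rewrite inE => /concat_left ->.
  refine (etrans _ (ge0_integral_rescale tau tau1 mg g0)); rewrite subrKC.
  rewrite -integral_itv_obnd_cbnd.
    by apply: eq_integral => s; rewrite inE => /concat_right ->.
  apply: (@eq_measurable_fun _ _ _ _ _ (concat tau f g)).
    by move=> s; rewrite inE => /concat_right ->.
  by apply: measurable_funS mfg => //; rewrite concat_split; exact: subsetUr.
- by rewrite -concat_split.
- move=> x xD; have /= : D x by rewrite concat_split.
  rewrite in_itv /= => /andP[x0 x1].
  rewrite /concat; case: ifPn => [xt|]; last rewrite -ltNge => xt.
    by apply: f0; rewrite in_itv /= ler_pdivlMr// mul0r x0 ler_pdivrMr// mul1r.
  apply: g0; rewrite in_itv /= ler_pdivlMr// mul0r ler_pdivrMr// mul1r.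
  by apply/andP; split; lra.
- apply/disj_setPS => x [] /=; rewrite !in_itv /= => /andP[_ xt] /andP[].
  by rewrite ltNge xt.
Qed.

Lemma integrable_concat (f g : R -> R) :
  lam.-integrable D (EFin \o f) -> lam.-integrable D (EFin \o g) ->
  lam.-integrable D (EFin \o concat tau f g).
Proof.
move=> /integrableP[mf jf] /integrableP[mg jg]; apply/integrableP.
have cE : EFin \o concat tau f g = concat tau (EFin \o f) (EFin \o g).
  by apply/funext => s; exact: (concat_comp tau EFin f g s).
split; first by rewrite cE; exact: measurable_concat.
rewrite (_ : (fun x => _) =
  concat tau (fun x => `|(f x)%:E|%E) (fun x => `|(g x)%:E|%E)).
  rewrite ge0_integral_concat//; try exact: measurableT_comp.
  by rewrite lte_add_pinfty// lte_mul_pinfty// lee_fin ltW.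
by apply/funext => s; rewrite cE (concat_comp tau abse).
Qed.

(** Reduces the signed integral to the nonnegative ones, for which the change of
    variables is available. *)
Lemma RintegralE f : lam.-integrable D (EFin \o f) ->
  \int[lam]_(x in D) f x =
  fine (\int[lam]_(x in D) (EFin \o f)^\+ x)%E -
  fine (\int[lam]_(x in D) (EFin \o f)^\- x)%E.
Proof.
move=> jf; rewrite /Rintegral integralE fineB//.
- exact: integrable_pos_fin_num.
- exact: integrable_neg_fin_num.
Qed.

Lemma Rintegral_concat (f g : R -> R) :
  lam.-integrable D (EFin \o f) -> lam.-integrable D (EFin \o g) ->
  \int[lam]_(x in D) concat tau f g x =
  tau * \int[lam]_(x in D) f x + (1 - tau) * \int[lam]_(x in D) g x.
Proof.
move=> jf jg; rewrite !RintegralE//; last exact: integrable_concat.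
have [mf mg] : measurable_fun D (EFin \o f) /\ measurable_fun D (EFin \o g).
  by split; [case/integrableP : jf|case/integrableP : jg].
have -> : ((EFin \o concat tau f g)^\+ =
    concat tau (EFin \o f)^\+ (EFin \o g)^\+)%E.
  by apply/funext => s; rewrite funeposE /= /concat; case: ifP; rewrite funeposE.
have -> : ((EFin \o concat tau f g)^\- =
    concat tau (EFin \o f)^\- (EFin \o g)^\-)%E.
  by apply/funext => s; rewrite funenegE /= /concat; case: ifP; rewrite funenegE.
rewrite !ge0_integral_concat//;
  try exact: measurable_funepos; try exact: measurable_funeneg.
have := integrable_pos_fin_num _ jf; have := integrable_pos_fin_num _ jg.
have := integrable_neg_fin_num _ jf; have := integrable_neg_fin_num _ jg.
move=> /(_ _)/fineK <- // /(_ _)/fineK <- // /(_ _)/fineK <- // /(_ _)/fineK <- //.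
by rewrite -!EFinM -!EFinD /=; ring.
Qed.

End concatenation.
(** * Means and action densities *)

Section mean_and_density.
Context {R : realType} (L : R * R -> R) (hL : admissible_mean L).
Local Notation D := (`[0%R, 1%R]%classic : set R).
Local Notation ad := (action_density L).
Implicit Types s t w m q : R.

Lemma mean_diag m : 0 < m -> L (m, m) = m.
Proof.
move=> m0; have := mean_homogeneous hL m0 ler01 ler01.
by rewrite mulr1 mean_11// mulr1.
Qed.

Lemma mean_mono s s' t t' : 0 <= s -> 0 <= t -> s <= s' -> t <= t' ->
  L (s, t) <= L (s', t').
Proof.
move=> s0 t0 ss tt; apply: (@le_trans _ _ (L (s', t))).
  exact: (mean_nondecreasing1 hL).
by apply: (mean_nondecreasing2 hL) => //; exact: le_trans ss.
Qed.

(** By homogeneity the mean of two equal numbers is that number; monotonicity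
    then places every mean between the smallest and the largest argument. *)
Lemma mean_ge m s t : 0 < m -> m <= s -> m <= t -> m <= L (s, t).
Proof. by move=> m0 ms mt; rewrite -{1}(mean_diag m0) mean_mono// ltW. Qed.

Lemma mean_le q s t : 0 < q -> 0 <= s <= q -> 0 <= t <= q -> L (s, t) <= q.
Proof.
by move=> q0 /andP[? ?] /andP[? ?]; rewrite -[leRHS](mean_diag q0) mean_mono.
Qed.

Lemma mean_gt0 s t : 0 < s -> 0 < t -> 0 < L (s, t).
Proof.
move=> s0 t0; have m0 : 0 < Num.min s t by rewrite lt_min s0.
by apply: (lt_le_trans m0); apply: mean_ge; rewrite ?ge_min ?lexx ?orbT.
Qed.

Lemma action_density_ge0 s t w : (0 <= ad s t w)%E.
Proof.
rewrite /action_density; case: ifPn => [/andP[s0 t0]|_]; last by case: ifP.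
by rewrite lee_fin divr_ge0 ?sqr_ge0// ltW// mean_gt0.
Qed.

Lemma action_density0 s t : 0 <= s -> 0 <= t -> ad s t 0 = 0%E.
Proof.
move=> s0 t0; rewrite /action_density s0 t0 eqxx /=.
by case: ifP => //; rewrite expr0n mul0r.
Qed.

Lemma action_density_anti s s' t t' w : 0 <= s -> 0 <= t -> s <= s' -> t <= t' ->
  (ad s' t' w <= ad s t w)%E.
Proof.
move=> s0 t0 ss tt; have s'0 := le_trans s0 ss; have t'0 := le_trans t0 tt.
rewrite {2}/action_density; case: ifPn => [/andP[s1 t1]|_].
  rewrite /action_density (lt_le_trans s1 ss) (lt_le_trans t1 tt) lee_fin.
  have L0 := mean_gt0 s1 t1; have LL := mean_mono s0 t0 ss tt.
  by rewrite ler_wpM2l ?sqr_ge0// lef_pV2// posrE (lt_le_trans L0).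
case: ifPn => [/and3P[/eqP-> _ _]|_]; last by rewrite leey.
by rewrite action_density0.
Qed.

Lemma action_densityZ c s t w : 0 < c ->
  (ad s t (c * w) = (c ^+ 2)%:E * ad s t w)%E.
Proof.
move=> c0; rewrite /action_density; case: ifPn => _.
  by rewrite -EFinM; congr EFin; ring.
rewrite mulf_eq0 (gt_eqF c0) /=; case: ifPn => _; first by rewrite mule0.
by rewrite gt0_muley// lte_fin exprn_gt0.
Qed.

Lemma action_density_ge q s t w : 0 < q -> 0 <= s <= q -> 0 <= t <= q ->
  ((w ^+ 2 / q)%:E <= ad s t w)%E.
Proof.
move=> q0 sq tq; rewrite /action_density; case: ifPn => [/andP[s0 t0]|_].
  rewrite lee_fin ler_wpM2l ?sqr_ge0// lef_pV2 ?posrE ?mean_gt0//.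
  exact: mean_le.
case: ifPn => [/and3P[/eqP-> _ _]|_]; last by rewrite leey.
by rewrite expr0n mul0r.
Qed.

Lemma action_density_le m s t w : 0 < m -> m <= s -> m <= t ->
  (ad s t w <= (w ^+ 2 / m)%:E)%E.
Proof.
move=> m0 ms mt; have s0 := lt_le_trans m0 ms; have t0 := lt_le_trans m0 mt.
rewrite /action_density s0 t0 lee_fin ler_wpM2l ?sqr_ge0//.
by rewrite lef_pV2 ?posrE ?mean_gt0// mean_ge.
Qed.

Lemma measurable_mean (s t : R -> R) :
  {within D, continuous s} -> {within D, continuous t} ->
  (forall u, 0 <= s u) -> (forall u, 0 <= t u) ->
  measurable_fun D (fun u => L (s u, t u)).
Proof.
move=> cs ct s0 t0; apply: within_continuous_measurable.
apply/subspace_continuousP => u Du.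
have st : (s v, t v) @[v --> within D (nbhs u)] --> (s u, t u).
  have csu := iffLR (subspace_continuousP _ _) cs u Du.
  have ctu := iffLR (subspace_continuousP _ _) ct u Du.
  exact: (cvg_pair csu ctu).
have := mean_continuous hL.
move/subspace_continuousP => /(_ (s u, t u)) /(_ (conj (s0 _) (t0 _))) cL.
apply: cvg_trans cL => A /= hA.
have := st _ hA; apply: (@filterS _ (within D (nbhs u))) => v.
by apply; split; [exact: s0|exact: t0].
Qed.

(** The density is discontinuous on the boundary of the quadrant, so its
    measurability along a curve has to be read off the case distinction. *)
Lemma measurable_action_density (s t w : R -> R) :
  {within D, continuous s} -> {within D, continuous t} ->
  (forall u, 0 <= s u) -> (forall u, 0 <= t u) -> measurable_fun D w ->
  measurable_fun D (fun u => ad (s u) (t u) (w u)).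
Proof.
move=> cs ct s0 t0 mw.
have [ms mt] : measurable_fun D s /\ measurable_fun D t.
  by split; exact: within_continuous_measurable.
rewrite /action_density; apply: measurable_fun_if => //.
- by apply: measurable_and; apply: measurable_fun_ltr.
- apply: (@measurable_funS _ _ _ _ D) => //.
  apply/measurable_EFinP; apply: measurable_funM; first exact: measurable_funX.
  have -> : (fun u => (L (s u, t u))^-1) = (@powR R ^~ (-1)) \o (fun u => L (s u, t u)).
    by apply/funext => u /=; rewrite powR_inv1// mean_ge0.
  by apply: measurableT_comp => //; exact: measurable_mean.
- apply: (@measurable_funS _ _ _ _ D) => //.
  apply: measurable_fun_if => //.
  apply: measurable_and; first exact: measurable_fun_eqr.
  by apply: measurable_and; exact: measurable_fun_ler.
Qed.

End mean_and_density.
(** * Energy of curves *)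

Section curves.
Context {R : realType} (L : R * R -> R) (hL : admissible_mean L).
Context {M : markov_triple R}.
Local Notation lam := (@lebesgue_measure R).
Local Notation D := (`[0%R, 1%R]%classic : set R).
Implicit Types (mu : R -> fprob R M) (V : R -> M -> M -> R) (W : M -> M -> R).

Definition outflow W (x : M) : R := 2^-1 * \sum_(y : M) (W x y - W y x).

Definition energy mu V : \bar R :=
  (\int[lam]_(t in `[0%R, 1%R]) action L (mu t) (V t))%E.

Lemma action_ge0 (nu : fprob R M) W : (0 <= action L nu W)%E.
Proof.
rewrite mule_ge0 ?lee_fin// sume_ge0// => x _; rewrite sume_ge0// => y _.
exact: action_density_ge0.
Qed.

Lemma energy_ge0 mu V : (0 <= energy mu V)%E.
Proof. by apply: integral_ge0 => t _; exact: action_ge0. Qed.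

Lemma actionZ (nu : fprob R M) W c : 0 < c ->
  (action L nu (fun x y => c * W x y)%R = (c ^+ 2)%:E * action L nu W)%E.
Proof.
move=> c0; rewrite /action muleCA; congr (_ * _)%E.
rewrite ge0_sume_distrr => [|x _]; last first.
  by rewrite sume_ge0// => y _; exact: action_density_ge0.
apply: eq_bigr => x _; rewrite ge0_sume_distrr => [|y _].
  by apply: eq_bigr => y _; rewrite action_densityZ.
exact: action_density_ge0.
Qed.

Lemma measurable_action (a b : fprob R M) mu V : continuity_eq a b mu V ->
  measurable_fun D (fun t => action L (mu t) (V t)).
Proof.
move=> [cmu iV _ _ _]; apply: emeasurable_funM => //.
have cflux x y : {within D, continuous (fun t : R => mu t x * rate x y)}.
  by move=> t; apply: cvgM; [exact: cmu|exact: cvg_cst].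
apply: emeasurable_sum => x; apply: emeasurable_sum => y.
apply: measurable_action_density => //.
- by move=> u; rewrite mulr_ge0 ?Defs.pmf_ge0 ?rate_ge0.
- by move=> u; rewrite mulr_ge0 ?Defs.pmf_ge0 ?rate_ge0.
- by case/integrableP : (iV x y) => /measurable_EFinP.
Qed.

Lemma integrable_outflow V x :
  (forall x y, lam.-integrable D (fun t => (V t x y)%:E)) ->
  lam.-integrable D (EFin \o (fun t => outflow (V t) x)).
Proof.
move=> iV.
rewrite (_ : EFin \o _ = (fun t =>
  2^-1%:E * \sum_(y : M) ((V t x y)%:E - (V t y x)%:E))%E).
  apply: integrableZl => //; apply: integrable_sum => // y _.
  by apply: integrableB => //; exact: iV.
apply/funext => t /=; rewrite EFinM -sumEFin.
by congr (_ * _)%E; apply: eq_bigr => y _; rewrite EFinB.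
Qed.

Lemma continuity_eq_boundary (a b : fprob R M) mu V x (phi : R -> R) :
  continuity_eq a b mu V -> smooth phi ->
  \int[lam]_(t in D) (derive1 phi t * mu t x) =
  phi 1 * b x - phi 0 * a x + \int[lam]_(t in D) (phi t * outflow (V t) x).
Proof.
move=> [cmu iV <- <- weak] sphi.
by rewrite (weak_derivative_boundary (cmu x) (integrable_outflow x iV) (weak x)).
Qed.

Lemma within_continuous_rescale (f : R -> R) (b k x y : R) : 0 < k ->
  b <= x -> y <= b + k ->
  {within D, continuous f} ->
  {within `[x, y], continuous (fun s => f ((s - b) / k))}.
Proof.
move=> k0 bx yk cf; apply/subspace_continuousP => s sxy.
have hD u : u \in `[x, y] -> D ((u - b) / k).
  rewrite /= !in_itv /= => /andP[? ?].
  by rewrite ler_pdivlMr// mul0r ler_pdivrMr// mul1r; apply/andP; split; lra.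
have cf' := iffLR (subspace_continuousP _ _) cf _ (hD _ sxy).
apply: cvg_trans cf' => A hA.
have h : (u - b) / k @[u --> s] --> (s - b) / k.
  by apply: cvgM; [apply: cvgB; [exact: cvg_id|exact: cvg_cst]|exact: cvg_cst].
have := h _ hA; apply: (@filterS _ (nbhs s)) => u Au uxy.
by apply: Au; exact: hD.
Qed.

Variables (tau : R) (tau01 : 0 < tau < 1).

Let tau0 : 0 < tau. Proof. by case/andP: tau01. Qed.
Let tau1 : 0 < 1 - tau. Proof. by case/andP: tau01; rewrite subr_gt0. Qed.

Lemma within_continuous_concat (f g : R -> R) : f 1 = g 0 ->
  {within D, continuous f} -> {within D, continuous g} ->
  {within D, continuous (concat tau f g)}.
Proof.
move=> fg cf cg.
have -> : D = `[0, tau]%classic `|` `[tau, 1]%classic.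
  rewrite (concat_split tau01); apply/seteqP; split=> t /=; rewrite !in_itv /=.
    by case=> [->|/andP[/ltW -> ->]]; [left|right].
  case=> [->|/andP[]]; first by left.
  rewrite le_eqVlt => /predU1P[<- _|-> ->]; last by right.
  by left; rewrite lexx ltW.
apply: withinU_continuous; try exact: interval_closed.
- have cf' := @within_continuous_rescale f 0 tau 0 tau tau0 (lexx _) _ cf.
  rewrite add0r in cf'; move: (cf' (lexx _)) => {}cf'.
  apply: (subspace_eq_continuous _ cf') => s; rewrite inE => sI.
  exact: (esym (concat_left f g sI)).
- have cg' := @within_continuous_rescale g tau (1 - tau) tau 1 tau1 (lexx _) _ cg.
  rewrite subrKC in cg'; move: (cg' (lexx _)) => {}cg'.
  apply: (subspace_eq_continuous _ cg') => s; rewrite inE /= in_itv /= => /andP[].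
  rewrite -[X in _ -> _ -> X]/(g ((s - tau) / (1 - tau)) = concat tau f g s).
  rewrite le_eqVlt => /predU1P[<- _|h1 h2].
    by rewrite subrr mul0r /concat lexx divff ?gt_eqF.
  by rewrite (@concat_right _ tau _ f g s)// in_itv /= h1.
Qed.

Definition concat_flux V1 V2 : R -> M -> M -> R :=
  concat tau (fun t x y => tau^-1 * V1 t x y)
    (fun t x y => (1 - tau)^-1 * V2 t x y).

Lemma concat_fluxE V1 V2 x y : (fun t => concat_flux V1 V2 t x y) =
  concat tau (fun t => tau^-1 * V1 t x y) (fun t => (1 - tau)^-1 * V2 t x y).
Proof.
by apply/funext => t; exact: (concat_comp tau (fun W : M -> M -> R => W x y)).
Qed.

Lemma outflowZ c W x : outflow (fun x y => c * W x y) x = c * outflow W x.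
Proof.
rewrite /outflow [RHS]mulrCA; congr (_ * _); rewrite mulr_sumr.
by apply: eq_bigr => y _; rewrite mulrBr.
Qed.

(** A test function of the concatenated curve restricts to two smooth functions
    which take the same value, at [tau], at the junction. The boundary terms of
    the two halves therefore cancel because both curves pass through [b]. *)
Lemma continuity_eq_concat (a b c : fprob R M) mu1 V1 mu2 V2 :
  continuity_eq a b mu1 V1 -> continuity_eq b c mu2 V2 ->
  continuity_eq a c (concat tau mu1 mu2) (concat_flux V1 V2).
Proof.
move=> ce1 ce2; have [c1 i1 a1 b1 w1] := ce1; have [c2 i2 b2 d2 w2] := ce2.
have cE x : (fun t => concat tau mu1 mu2 t x) =
    concat tau (fun t => mu1 t x) (fun t => mu2 t x).
  by apply/funext => t; exact: (concat_comp tau (fun nu : fprob R M => nu x)).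
split.
- by move=> x; rewrite cE; apply: within_continuous_concat => //; rewrite b1 b2.
- move=> x y.
  rewrite (_ : (fun t => _) = EFin \o (fun t => concat_flux V1 V2 t x y))//.
  rewrite concat_fluxE; apply: integrable_concat => //.
    exact: integrableZl (i1 x y).
  exact: integrableZl (i2 x y).
- by rewrite /concat (ltW tau0) mul0r.
- have /negbTE t1 : ~~ (1 <= tau) by rewrite -ltNge -subr_gt0.
  by rewrite /concat t1 divff ?gt_eqF.
move=> x phi tphi; have sphi := test_function_smooth tphi.
(* [+ 0] brings the first restriction to the form of an affine substitution *)
pose phi1 := fun u : R => phi (tau * u + 0).
pose phi2 := fun u : R => phi ((1 - tau) * u + tau).
have s1 : smooth phi1 by exact: smooth_affine.
have s2 : smooth phi2 by exact: smooth_affine.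
have phi10 s : phi s = phi1 (s / tau).
  by rewrite /phi1 addr0 mulrCA divff ?mulr1// gt_eqF.
have phi20 s : phi s = phi2 ((s - tau) / (1 - tau)).
  by rewrite /phi2 mulrCA divff ?gt_eqF// mulr1 subrK.
have dphi10 s : derive1 phi s = tau^-1 * derive1 phi1 (s / tau).
  rewrite /phi1 derive1_affine// mulrA mulVf ?gt_eqF// mul1r.
  by rewrite addr0 mulrCA divff ?mulr1// gt_eqF.
have dphi20 s :
    derive1 phi s = (1 - tau)^-1 * derive1 phi2 ((s - tau) / (1 - tau)).
  rewrite /phi2 derive1_affine// mulrA mulVf ?gt_eqF// mul1r.
  by rewrite mulrCA divff ?gt_eqF// mulr1 subrK.
have e1 := continuity_eq_boundary x ce1 s1.
have e2 := continuity_eq_boundary x ce2 s2.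
have [p0 p1] := test_function_endpoints tphi.
have ic1 := within_continuous_integrable
  (within_continuousM (smooth_within (smooth_derive1 s1)) (c1 x)).
have ic2 := within_continuous_integrable
  (within_continuousM (smooth_within (smooth_derive1 s2)) (c2 x)).
have io1 := within_continuous_integrableM (smooth_within s1)
  (integrable_outflow x i1).
have io2 := within_continuous_integrableM (smooth_within s2)
  (integrable_outflow x i2).
transitivity (\int[lam]_(s in D) concat tau
    (fun t => tau^-1 * (derive1 phi1 t * mu1 t x))
    (fun t => (1 - tau)^-1 * (derive1 phi2 t * mu2 t x)) s).
  apply: eq_Rintegral => s _; rewrite /concat; case: ifP => _.
    by rewrite dphi10 mulrA.
  by rewrite dphi20 mulrA.
transitivity (\int[lam]_(s in D) concat tau
    (fun t => tau^-1 * (phi1 t * outflow (V1 t) x))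
    (fun t => (1 - tau)^-1 * (phi2 t * outflow (V2 t) x)) s); last first.
  apply: eq_Rintegral => s _; rewrite -[X in _ = _ * X]/(outflow _ x).
  rewrite /concat_flux /concat; case: ifP => _; rewrite outflowZ.
    by rewrite [in RHS]phi10 mulrCA.
  by rewrite [in RHS]phi20 mulrCA.
have iZ (k : R) f : lam.-integrable D (EFin \o f) ->
    lam.-integrable D (EFin \o (fun t => k * f t)).
  by move=> jf; exact: integrableZl jf.
rewrite (Rintegral_concat tau01 (iZ _ _ ic1) (iZ _ _ ic2)).
rewrite (Rintegral_concat tau01 (iZ _ _ io1) (iZ _ _ io2)).
rewrite !RintegralZl//= e1 e2 !mulrA !divff ?gt_eqF// !mul1r.
have -> : phi1 0 = 0 by rewrite /phi1 mulr0 addr0.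
have -> : phi2 1 = 0 by rewrite /phi2 mulr1 subrK.
have -> : phi1 1 = phi tau by rewrite /phi1 mulr1 addr0.
have -> : phi2 0 = phi tau by rewrite /phi2 mulr0 add0r.
by rewrite !mul0r; lra.
Qed.

(** Running a curve in time [tau] multiplies its action by [tau ^- 2] and the
    length of the time interval by [tau]. *)
Lemma energy_concat (a b c : fprob R M) mu1 V1 mu2 V2 :
  continuity_eq a b mu1 V1 -> continuity_eq b c mu2 V2 ->
  energy (concat tau mu1 mu2) (concat_flux V1 V2) =
  (tau^-1%:E * energy mu1 V1 + (1 - tau)^-1%:E * energy mu2 V2)%E.
Proof.
move=> ce1 ce2; have m1 := measurable_action ce1; have m2 := measurable_action ce2.
rewrite /energy.
under eq_integral => t _.
  rewrite (_ : action _ _ _ = concat tau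
     (fun t => (tau^-1 ^+ 2)%:E * action L (mu1 t) (V1 t))%E
     (fun t => ((1 - tau)^-1 ^+ 2)%:E * action L (mu2 t) (V2 t))%E t); last first.
    by rewrite /concat_flux /concat; case: ifP => _; rewrite actionZ// invr_gt0.
  over.
have pos (u : R) (nu : fprob R M) W : (0 <= (u ^+ 2)%:E * action L nu W)%E.
  by rewrite mule_ge0 ?action_ge0 ?lee_fin ?sqr_ge0.
have Z (u : R) mu V : measurable_fun D (fun t => action L (mu t) (V t)) ->
    (\int[lam]_(t in `[0%R, 1%R]) ((u ^+ 2)%:E * action L (mu t) (V t)) =
     (u ^+ 2)%:E * energy mu V)%E.
  move=> m; apply: ge0_integralZl => //; last by rewrite lee_fin sqr_ge0.
  by move=> t _; exact: action_ge0.
rewrite ge0_integral_concat//; try exact: emeasurable_funM.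
rewrite (Z _ _ _ m1) (Z _ _ _ m2) !muleA -!EFinM !expr2.
by rewrite !mulrA !divff ?gt_eqF// !mul1r.
Qed.

End curves.
(** * Push-forward of a curve along a map of states *)

Section pushforward.
Context {R : realType} {M : markov_triple R} (p : M -> M).
Local Notation lam := (@lebesgue_measure R).
Local Notation D := (`[0%R, 1%R]%classic : set R).
Implicit Types (nu : fprob R M) (W : M -> M -> R).

Lemma push_pmf_axiom nu :
  [forall x, 0 <= \sum_(a | p a == x) nu a] &&
  (\sum_x \sum_(a | p a == x) nu a == 1).
Proof.
apply/andP; split.
  by apply/forallP => x; rewrite sumr_ge0// => a _; exact: Defs.pmf_ge0.
by apply/eqP; rewrite -(pmf_sum1 nu) [RHS](partition_big p xpredT).
Qed.

Definition push_prob nu : fprob R M := Fprob (push_pmf_axiom nu).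

(** The diagonal is set to 0 since rates vanish there and a nonzero flux would
    have infinite action. *)
Definition push_flux W (x y : M) : R :=
  if x == y then 0 else \sum_(a | p a == x) \sum_(b | p b == y) W a b.

(** The outflow is antisymmetrized in the two ends of an edge, so the flux
    inside a fibre cancels and setting it to 0 does no harm. *)
Lemma outflow_push W x :
  outflow (push_flux W) x = \sum_(a | p a == x) outflow W a.
Proof.
rewrite /outflow -mulr_sumr; congr (_ * _).
pose c a b := W a b - W b a.
transitivity (\sum_y \sum_(a | p a == x) \sum_(b | p b == y) c a b).
  apply: eq_bigr => y _; rewrite /push_flux (eq_sym y); case: eqVneq => [<-|_].
    under [RHS]eq_bigr do rewrite sumrB.
    by rewrite sumrB [X in _ = _ - X]exchange_big /= !subrr.
  rewrite [X in _ - X]exchange_big /= -sumrB.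
  by apply: eq_bigr => a _; rewrite -sumrB.
rewrite exchange_big; apply: eq_bigr => a _.
by rewrite [RHS](partition_big p xpredT).
Qed.

Lemma continuity_eq_push (a b : fprob R M) mu V : continuity_eq a b mu V ->
  continuity_eq (push_prob a) (push_prob b)
    (fun t => push_prob (mu t)) (fun t => push_flux (V t)).
Proof.
move=> [cmu iV a0 b1 weak]; split.
- by move=> x; exact: within_continuous_sum.
- move=> x y; rewrite /push_flux; case: eqVneq => _.
    exact: (within_continuous_integrable (fun x => cvg_cst _)).
  apply: (@integrable01_sum _ _ _ _ (fun a t => \sum_(b | p b == y) V t a b)) => i.
  by apply: (@integrable01_sum _ _ _ _ (fun b t => V t i b)) => j; exact: iV.
- by rewrite a0.
- by rewrite b1.
move=> x phi tphi; have sphi := test_function_smooth tphi.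
transitivity (\sum_(a | p a == x) \int[lam]_(t in D) (derive1 phi t * mu t a)).
  rewrite -Rintegral01_sum; first by apply: eq_Rintegral => t _; rewrite mulr_sumr.
  move=> i; apply: within_continuous_integrable; apply: within_continuousM => //.
  exact/smooth_within/smooth_derive1.
transitivity (\sum_(a | p a == x) \int[lam]_(t in D) (phi t * outflow (V t) a)).
  by apply: eq_bigr => i _; exact: weak.
rewrite -Rintegral01_sum.
  apply: eq_Rintegral => t _; rewrite -mulr_sumr -outflow_push.
  by [].
move=> i; apply: within_continuous_integrableM; first exact: smooth_within.
exact: integrable_outflow.
Qed.

End pushforward.
Lemma sqr_sum_le (R : realFieldType) (I : finType) (f : I -> R) :
  (\sum_i f i) ^+ 2 <= #|I|%:R * \sum_i f i ^+ 2.
Proof.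
have : 0 <= \sum_i \sum_j (f i - f j) ^+ 2.
  by apply: sumr_ge0 => i _; apply: sumr_ge0 => j _; rewrite sqr_ge0.
rewrite (eq_bigr (fun i => #|I|%:R * f i ^+ 2 + \sum_j f j ^+ 2 - 2 * f i * \sum_j f j)).
  rewrite sumrB big_split /= -mulr_sumr sumr_const -mulr_suml -mulr_sumr.
  by rewrite -[X in _ + X - _]mulr_natl expr2; lra.
move=> i _; rewrite mulr_natl -sumr_const mulr_sumr -big_split -sumrB /=.
by apply: eq_bigr => j _; ring.
Qed.

(** * Collapsing a set behind a cut vertex *)

Section collapse.
Context {R : realType} (L : R * R -> R) (hL : admissible_mean L).
Context {M : markov_triple R} (B : {pred M}) (o : M).
Hypothesis oB : o \notin B.
Hypothesis cut : forall x y, x \notin B -> x != o -> y \in B -> rate x y = 0.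
Local Notation lam := (@lebesgue_measure R).
Local Notation D := (`[0%R, 1%R]%classic : set R).
Implicit Types (nu : fprob R M) (W : M -> M -> R) (x y : M).

Definition collapse (x : M) : M := if x \in B then o else x.

Definition flux_out W : R := \sum_(x in B) outflow W x.

Definition rate_bound : R := 1 + \sum_(x : M) \sum_(y : M) rate x y.

(** The factor 2 comes from the 1/2 in the action, [rate_bound] bounds the mean
    on every edge, and the number of pairs of states comes from the
    Cauchy-Schwarz inequality; the added 1 keeps the constant positive. *)
Definition leak_constant : R := (2 * rate_bound * (#|{: M * M}|%:R + 1))^-1.

Lemma rate_bound_gt0 : 0 < rate_bound.
Proof.
rewrite ltr_pwDl// sumr_ge0// => x _; rewrite sumr_ge0// => y _.
exact: rate_ge0.
Qed.

Lemma rate_le_bound (x y : M) : rate x y <= rate_bound.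
Proof.
rewrite /rate_bound (bigD1 x)//= (bigD1 y)//=.
have h1 : 0 <= \sum_(i | i != y) rate x i by rewrite sumr_ge0// => *; exact: rate_ge0.
have h2 : 0 <= \sum_(i | i != x) \sum_j rate i j.
  by rewrite sumr_ge0// => i _; rewrite sumr_ge0// => *; exact: rate_ge0.
by move: h1 h2; lra.
Qed.

Lemma leak_constant_gt0 : 0 < leak_constant.
Proof. by rewrite invr_gt0 !mulr_gt0 ?rate_bound_gt0// ltr_wpDl. Qed.

Lemma fprob_le1 nu x : nu x <= 1.
Proof.
by rewrite -(pmf_sum1 nu) (bigD1 x)//= lerDl sumr_ge0// => *; exact: Defs.pmf_ge0.
Qed.

Lemma fprob_rate_bound nu x y : 0 <= nu x * rate x y <= rate_bound.
Proof.
rewrite mulr_ge0 ?Defs.pmf_ge0 ?rate_ge0//=.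
apply: le_trans (rate_le_bound x y).
by rewrite ler_piMl ?rate_ge0// fprob_le1.
Qed.

Lemma rate_eq0_sym (x y : M) : rate x y = 0 -> rate y x = 0.
Proof.
move=> xy; have := stat_reversible y x; rewrite xy mulr0 => /eqP.
by rewrite mulf_eq0 gt_eqF ?stat_gt0//= => /eqP.
Qed.

(** Finite action forbids flux off the edges of the graph. This is what makes
    [o] a cut vertex for the flux as well. *)
Lemma flux_eq0_off_edges nu W x y : (action L nu W < +oo)%E ->
  rate x y = 0 -> W x y = 0.
Proof.
move=> fin xy; apply/eqP/negPn/negP => Wxy; move: fin; apply/negP.
rewrite -leNgt leye_eq.
have ad0 a b :
    (0 <= action_density L (nu a * rate a b) (nu b * rate b a) (W a b))%E.
  exact: action_density_ge0.
rewrite /action (bigD1 x)//= (bigD1 y)//=.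
have -> : action_density L (nu x * rate x y) (nu y * rate y x) (W x y) = +oo%E.
  by rewrite /action_density xy mulr0 ltxx /= (negbTE Wxy).
rewrite addye ?addye ?gt0_muley ?lte_fin//.
- by rewrite gt_eqF// (lt_le_trans (ltNyr 0))// sume_ge0// => i _; exact: sume_ge0.
- by rewrite gt_eqF// (lt_le_trans (ltNyr 0))// sume_ge0.
Qed.

Lemma push_prob_ge nu x : x \notin B -> nu x <= push_prob collapse nu x.
Proof.
move=> xB; rewrite /= (bigD1 x)/=; last by rewrite /collapse (negbTE xB).
by rewrite lerDl sumr_ge0// => *; exact: Defs.pmf_ge0.
Qed.

(** Off [B] the fibres of the collapse are singletons, except that of [o], which
    also contains [B]; but no flux of finite action goes from [B] to states
    other than [o]. *)
Lemma push_fluxE nu W x y : (action L nu W < +oo)%E ->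
  x \notin B -> y \notin B -> x != y -> push_flux collapse W x y = W x y.
Proof.
move=> fin xB yB xy; rewrite /push_flux (negbTE xy).
have px : collapse x == x by rewrite /collapse (negbTE xB).
have py : collapse y == y by rewrite /collapse (negbTE yB).
have fib a z : collapse a == z -> a != z -> a \in B /\ z = o.
  by rewrite /collapse; case: ifP => [? /eqP <-|_ /eqP->] //; rewrite eqxx.
have fib' a z : collapse a == z -> z != o -> a = z.
  by move=> az zo; apply/eqP/negPn/negP => /(fib _ _ az)[_ /eqP]; rewrite (negbTE zo).
rewrite (bigD1 x)//= (bigD1 y)//= [X in _ + X]big1 ?addr0; last first.
  move=> a /andP[ax /(fib _ _ ax)[aB xo]]; apply: big1 => b yb.
  have yo : y != o by rewrite -xo eq_sym.
  rewrite (fib' _ _ yb yo); apply: (flux_eq0_off_edges fin); apply: rate_eq0_sym.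
  exact: cut.
rewrite big1 ?addr0// => b /andP[yb /(fib _ _ yb)[bB yo]].
by apply: (flux_eq0_off_edges fin); apply: cut => //; rewrite -yo.
Qed.

Lemma push_flux_eq0 W x y : (x \in B) || (y \in B) ->
  push_flux collapse W x y = 0.
Proof.
have emp z a : z \in B -> (collapse a == z) = false.
  move=> zB; rewrite /collapse; case: ifPn => aB;
    apply/negbTE; apply: contraTneq zB => <- //.
rewrite /push_flux => /orP[] h; case: eqP => // _.
  by apply: big_pred0 => a; exact: emp.
by apply: big1 => a _; apply: big_pred0 => b; exact: emp.
Qed.

(** Every term of the flux out of [B] lives on a pair that meets [B], and each
    pair occurs at most once with its direction and once reversed, each time
    with the factor 1/2. *)
Lemma flux_out_le W :
  leak_constant * flux_out W ^+ 2 <=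
  2^-1 * \sum_x \sum_y
    (if (x \in B) || (y \in B) then W x y ^+ 2 / rate_bound else 0).
Proof.
pose bad (u : M * M) := (u.1 \in B) || (u.2 \in B).
pose f (u : M * M) := if bad u then `|W u.1 u.2| else 0.
have f0 u : 0 <= f u by rewrite /f; case: ifP.
have le1 : `|flux_out W| <= \sum_u f u.
  apply: (@le_trans _ _ (\sum_(x in B) \sum_y (2^-1 * (`|W x y| + `|W y x|)))).
    apply: (le_trans (ler_norm_sum _ _ _)); apply: ler_sum => x _.
    rewrite /outflow normrM ger0_norm ?invr_ge0// -mulr_sumr ler_wpM2l ?invr_ge0//.
    apply: (le_trans (ler_norm_sum _ _ _)); apply: ler_sum => y _.
    exact: ler_normB.
  have h1 : \sum_(x in B) \sum_y `|W x y| <= \sum_u f u.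
    rewrite -(pair_bigA _ (fun x y => f (x, y)))/= [leRHS](bigID (mem B))/=.
    rewrite -[leLHS]addr0 lerD//; last by apply: sumr_ge0 => *; exact: sumr_ge0.
    by apply: ler_sum => x xB; apply: ler_sum => y _; rewrite /f /bad /= xB.
  have h2 : \sum_(x in B) \sum_y `|W y x| <= \sum_u f u.
    rewrite -(pair_bigA _ (fun x y => f (x, y)))/= exchange_big /=.
    apply: ler_sum => x _; rewrite [leRHS](bigID (mem B))/=.
    rewrite -[leLHS]addr0 lerD//; last exact: sumr_ge0.
    by apply: ler_sum => y yB; rewrite /f /bad /= yB orbT.
  under eq_bigr do rewrite -mulr_sumr big_split /=.
  by rewrite -mulr_sumr big_split /=; lra.
have le2 : flux_out W ^+ 2 <= #|{: M * M}|%:R * \sum_u f u ^+ 2.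
  apply: le_trans (sqr_sum_le f); rewrite -(real_normK (num_real (flux_out W))).
  by rewrite lerXn2r ?nnegrE// sumr_ge0.
have -> : \sum_x \sum_y
      (if (x \in B) || (y \in B) then W x y ^+ 2 / rate_bound else 0) =
    (\sum_u f u ^+ 2) / rate_bound.
  rewrite -(pair_bigA _ (fun x y => f (x, y) ^+ 2))/= mulr_suml.
  apply: eq_bigr => x _; rewrite mulr_suml; apply: eq_bigr => y _.
  rewrite /f /bad /=; case: ifP => _; last by rewrite expr0n mul0r.
  by rewrite real_normK// num_real.
have S0 : 0 <= \sum_u f u ^+ 2 by apply: sumr_ge0 => *; exact: sqr_ge0.
have q0 := rate_bound_gt0; have n0 : 0 <= #|{: M * M}|%:R :> R by [].
rewrite /leak_constant mulrC ler_pdivrMr; last by rewrite !mulr_gt0// ltr_wpDl.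
rewrite (_ : 2^-1 * _ * _ = (#|{: M * M}|%:R + 1) * \sum_u f u ^+ 2).
  by rewrite (le_trans le2)// ler_wpM2r// lerDl.
by field; rewrite gt_eqF.
Qed.

(** The comparison is made pair by pair: outside [B] masses grow and fluxes
    agree; a pair meeting [B] loses all of its action, which is at least the
    square of its flux divided by [rate_bound]. When the action of [W] is
    infinite there is nothing to compare, so [W] may be assumed to live on the
    edges. *)
Lemma action_collapse nu W :
  (action L (push_prob collapse nu) (push_flux collapse W) +
   (leak_constant * flux_out W ^+ 2)%:E <= action L nu W)%E.
Proof.
have [fin|] := ltP (action L nu W) +oo%E; last first.
  by rewrite leye_eq => /eqP ->; rewrite leey.
pose b x y := if (x \in B) || (y \in B) then W x y ^+ 2 / rate_bound else 0.
have key x y : (action_density L (push_prob collapse nu x * rate x y)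
      (push_prob collapse nu y * rate y x) (push_flux collapse W x y) +
      (b x y)%:E <=
    action_density L (nu x * rate x y) (nu y * rate y x) (W x y))%E.
  have ge0 (rho : fprob R M) u v : 0 <= rho u * rate u v.
    by rewrite mulr_ge0 ?Defs.pmf_ge0 ?rate_ge0.
  rewrite /b; case: ifPn => [xyB|].
    rewrite push_flux_eq0// action_density0// add0e.
    apply: action_density_ge => //; first exact: rate_bound_gt0.
      exact: fprob_rate_bound.
    exact: fprob_rate_bound.
  rewrite negb_or adde0 => /andP[xB yB]; have [->|xy] := eqVneq x y.
    by rewrite /push_flux eqxx action_density0// action_density_ge0.
  rewrite (push_fluxE fin)//; apply: action_density_anti => //.
    by rewrite ler_wpM2r ?rate_ge0// push_prob_ge.
  by rewrite ler_wpM2r ?rate_ge0// push_prob_ge.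
apply: le_trans (_ : 2^-1%:E * (\sum_x \sum_y
    (action_density L (push_prob collapse nu x * rate x y)
      (push_prob collapse nu y * rate y x) (push_flux collapse W x y) +
     (b x y)%:E)) <= _)%E; last first.
  rewrite lee_wpmul2l ?lee_fin ?invr_ge0//.
  by apply: lee_sum => x _; apply: lee_sum => y _; exact: key.
under eq_bigr => x _ do rewrite big_split /= sumEFin.
rewrite big_split /= sumEFin muleDr//; last first.
  apply: ge0_adde_def; rewrite inE; last first.
    by rewrite lee_fin sumr_ge0// => x _; rewrite sumr_ge0// => y _; rewrite /b;
      case: ifP => // _; rewrite divr_ge0 ?sqr_ge0// ltW// rate_bound_gt0.
  by rewrite sume_ge0// => x _; rewrite sume_ge0// => y _; exact: action_density_ge0.
by rewrite leeD// -EFinM lee_fin flux_out_le.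
Qed.

(** Integrate [action_collapse] in time. By the continuity equation tested with
    the constant 1, the integral of the flux out of [B] is the loss of mass of
    [B]; Jensen's inequality bounds the integral of its square from below. *)
Lemma energy_collapse (a b : fprob R M) mu V : continuity_eq a b mu V ->
  (energy L (fun t => push_prob collapse (mu t))
     (fun t => push_flux collapse (V t)) +
   (leak_constant * (\sum_(x in B) a x - \sum_(x in B) b x) ^+ 2)%:E <= energy L mu V)%E.
Proof.
move=> ce; have cep := continuity_eq_push collapse ce.
have mp := measurable_action hL cep; have m := measurable_action hL ce.
case: (ce) => cmu iV _ _ _.
pose G t := flux_out (V t).
have jG : lam.-integrable D (EFin \o G).
  by apply: integrable01_sum => x; exact: integrable_outflow.
have mG2 : measurable_fun D (fun t => (leak_constant * G t ^+ 2)%:E).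
  apply/measurable_EFinP; apply: measurable_funM => //; apply: measurable_funX.
  by case/integrableP : jG => /measurable_EFinP.
have GE : \int[lam]_(t in D) G t = \sum_(x in B) a x - \sum_(x in B) b x.
  rewrite Rintegral01_sum; last by move=> x; exact: integrable_outflow.
  rewrite -sumrB; apply: eq_bigr => x _.
  have := continuity_eq_boundary x ce (smooth_cst 1).
  under eq_Rintegral do rewrite derive1_cst mul0r.
  rewrite Rintegral_cst// mul0r.
  under [X in _ = _ + X]eq_Rintegral do rewrite mul1r.
  by rewrite /= !mul1r => /eqP; rewrite eq_sym addrC addr_eq0 opprB => /eqP.
rewrite -GE; apply: (@le_trans _ _ (\int[lam]_(t in `[0%R, 1%R])
   (action L (push_prob collapse (mu t)) (push_flux collapse (V t)) +
    (leak_constant * G t ^+ 2)%:E))%E); last first.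
  apply: ge0_le_integral => //.
  - move=> t _; rewrite adde_ge0 ?action_ge0// lee_fin mulr_ge0 ?sqr_ge0// ltW//.
    exact: leak_constant_gt0.
  - exact: emeasurable_funD.
  - by move=> t _; exact: action_collapse.
rewrite ge0_integralD//; first last.
- by move=> t _; rewrite lee_fin mulr_ge0 ?sqr_ge0// ltW// leak_constant_gt0.
- by move=> t _; exact: action_ge0.
rewrite leeD//; under eq_integral do rewrite EFinM.
rewrite ge0_integralZl//; first last.
- by rewrite lee_fin ltW// leak_constant_gt0.
- by move=> t _; rewrite lee_fin sqr_ge0.
- apply/measurable_EFinP; apply: measurable_funX.
  by case/integrableP : jG => /measurable_EFinP.
rewrite EFinM lee_wpmul2l ?lee_fin ?(ltW leak_constant_gt0)//.
exact: sqr_Rintegral_le.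
Qed.

End collapse.
(** * Finiteness of the distance *)

Section finite_energy.
Context {R : realType} (L : R * R -> R) (hL : admissible_mean L).
Context {M : markov_triple R}.
Local Notation lam := (@lebesgue_measure R).
Local Notation D := (`[0%R, 1%R]%classic : set R).
Implicit Types (x y z : M) (U : M -> M -> R) (p : {poly R}) (t : R).

Lemma smooth_horner p : smooth (horner p).
Proof.
move=> n; elim: n p => // n IH p.
by apply: nderivableS (IH (deriv p)) => t; exact: is_derive_poly.
Qed.

Lemma derive1_horner p t : derive1 (horner p) t = (deriv p).[t].
Proof. by rewrite derive1E; case: (is_derive_poly p t). Qed.

Definition on_edges U := forall x y, rate x y = 0 -> U x y = 0.

Lemma outflowD U1 U2 z :
  outflow (fun x y => U1 x y + U2 x y) z = outflow U1 z + outflow U2 z.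
Proof.
rewrite /outflow -mulrDr -big_split; congr (_ * _).
by apply: eq_bigr => y _; rewrite /=; ring.
Qed.

(** Send one unit along a path of the irreducible graph. The outflow halves the
    flux, whence the factor 2 on each edge. *)
Lemma flow_between x y : exists U, on_edges U /\
  forall z, outflow U z = (z == x)%:R - (z == y)%:R.
Proof.
have /connectP[s + ->] := rate_irreducible x y.
elim: s x => [x _|w s IH x /= /andP[xw /IH[U [eU oU]]]].
  exists (fun _ _ => 0); split=> // z.
  by rewrite subrr /outflow big1 ?mulr0// => i _; rewrite subrr.
exists (fun a b => (2 * ((a == x) && (b == w))%:R) + U a b); split=> [a b ab|z].
  rewrite eU// addr0; case: eqVneq => [ax|]; last by rewrite mulr0.
  case: eqVneq => [bw|]; last by rewrite mulr0.
  by move: xw; rewrite -ax -bw ab ltxx.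
rewrite outflowD oU /outflow -[RHS](subrKA (z == w)%:R); congr (_ + _).
rewrite sumrB (bigD1 w)//= big1 => [|i /negbTE ->]; last by rewrite andbF mulr0.
rewrite (bigD1 x)//= big1 => [|i /negbTE ->]; last by rewrite mulr0.
rewrite !eqxx !andbT !addr0 /= -mulrBr mulrA mulVf ?mul1r//.
Qed.

(** Route the surplus of every state to a common base point. *)
Lemma flow_exists (f : M -> R) : \sum_x f x = 0 ->
  exists U, on_edges U /\ forall z, outflow U z = f z.
Proof.
move=> f0; case: (pickP (fun _ : M => true)) => [x0 _|M0]; last first.
  by exists (fun _ _ => 0); split=> [//|z]; have := M0 z.
have [U hU] := choice (fun x => flow_between x x0).
exists (fun a b => \sum_x f x * U x a b); split=> [a b ab|z].
  by apply: big1 => x _; case: (hU x) => /(_ _ _ ab) -> _; rewrite mulr0.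
have -> : outflow (fun a b => \sum_x f x * U x a b) z = \sum_x f x * outflow (U x) z.
  rewrite /outflow; under [RHS]eq_bigr do rewrite mulrCA mulr_sumr.
  rewrite -mulr_sumr exchange_big; congr (_ * _); apply: eq_bigr => y _ /=.
  by rewrite -sumrB; apply: eq_bigr => x _; rewrite mulrBr.
rewrite (eq_bigr (fun x => f x * (z == x)%:R - f x * (z == x0)%:R)); last first.
  by move=> x _; case: (hU x) => _ ->; rewrite mulrBr.
rewrite sumrB -mulr_suml f0 mul0r subr0 (bigD1 z)//= eqxx mulr1 big1 ?addr0//.
by move=> x /negbTE; rewrite eq_sym => ->; rewrite mulr0.
Qed.

Variables a b : fprob R M.

(** [mix] may take negative values for parameters outside [[0, 1]], while curves
    are functions on the whole line. *)
Definition clamp (s : R) : R := if 0 <= s <= 1 then s else 0.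

Lemma clamp01 s : 0 <= clamp s <= 1.
Proof. by rewrite /clamp; case: ifP => //; rewrite lexx ler01. Qed.

(** The Bernstein path from [a] to [b] with the stationary measure as middle
    control point; inside the unit interval it charges every state. *)
Definition mix (s : R) x : R :=
  (1 - s) ^+ 2 * a x + 2 * s * (1 - s) * stat M x + s ^+ 2 * b x.

Lemma mix_pmf_axiom s :
  [forall x, 0 <= mix (clamp s) x] && (\sum_x mix (clamp s) x == 1).
Proof.
have /andP[c0 c1] := clamp01 s; apply/andP; split.
  by apply/forallP => x; rewrite !addr_ge0 ?mulr_ge0 ?sqr_ge0 ?subr_ge0 ?Defs.pmf_ge0.
by rewrite !big_split /= -!mulr_sumr !pmf_sum1; apply/eqP; ring.
Qed.

Definition mix_prob s : fprob R M := Fprob (mix_pmf_axiom s).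

(** This reparametrization has zero speed at both ends, where the mass supplied
    by the stationary measure vanishes: the square of the speed is at most 36
    times [s (1 - s)], which is what keeps the action bounded. *)
Definition schedule : {poly R} := 3%:P * 'X ^+ 2 - 2%:P * 'X ^+ 3.

Lemma scheduleE t : schedule.[t] = 3 * t ^+ 2 - 2 * t ^+ 3.
Proof. by rewrite /schedule !hornerE. Qed.

Lemma deriv_scheduleE t : (deriv schedule).[t] = 6 * t * (1 - t).
Proof.
rewrite /schedule !poly.derivE !hornerE /=; ring.
Qed.

Lemma schedule01 t : 0 <= t <= 1 -> 0 <= schedule.[t] <= 1.
Proof.
move=> /andP[t0 t1]; rewrite scheduleE.
have h0 : 0 <= t ^+ 2 * (3 - 2 * t) by rewrite mulr_ge0 ?sqr_ge0//; lra.
have h1 : 0 <= (1 - t) ^+ 2 * (1 + 2 * t) by rewrite mulr_ge0 ?sqr_ge0//; lra.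
by apply/andP; split; lra.
Qed.

Lemma deriv_schedule_le t : 0 <= t <= 1 ->
  (deriv schedule).[t] ^+ 2 <= 36 * (schedule.[t] * (1 - schedule.[t])).
Proof.
move=> /andP[t0 t1]; rewrite deriv_scheduleE scheduleE.
have t1' : 0 <= 1 - t by rewrite subr_ge0.
have t2 : 0 <= t ^+ 2 * (1 - t) ^+ 2 by rewrite mulr_ge0 ?sqr_ge0.
rewrite -subr_ge0.
rewrite (_ : _ - _ = 36 * (t ^+ 2 * (1 - t) ^+ 2) * ((3 - 2 * t) * (1 + 2 * t) - 1)).
  by rewrite mulr_ge0 ?mulr_ge0//; nra.
by ring.
Qed.

Definition mix_poly x : {poly R} := (1 - schedule) ^+ 2 * (a x)%:P +
  2%:P * schedule * (1 - schedule) * (stat M x)%:P + schedule ^+ 2 * (b x)%:P.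

Lemma mix_polyE t x : 0 <= t <= 1 -> (mix_poly x).[t] = mix_prob schedule.[t] x.
Proof.
move=> t01; rewrite /= /clamp schedule01// /mix /mix_poly !hornerE; ring.
Qed.

Lemma deriv_mix_poly t x : (deriv (mix_poly x)).[t] = 2 * (deriv schedule).[t] *
  ((1 - schedule.[t]) * (stat M x - a x) + schedule.[t] * (b x - stat M x)).
Proof.
rewrite /mix_poly; move: schedule => s; rewrite !poly.derivE !hornerE /=; ring.
Qed.

(** Along the scheduled Bernstein path the required outflow is the speed times a
    combination of two fixed zero-sum functions, which are realized by flows
    along the edges. On each edge both arguments of the mean are at least
    [2 s (1 - s)] times the same number, by reversibility, so that the action is
    at most the square of the speed divided by [s (1 - s)], up to a constant. *)
Lemma finite_energy :
  exists c, continuity_eq a b c.1 c.2 /\ (energy L c.1 c.2 < +oo)%E.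
Proof.
have [U0 [eU0 oU0]] : exists U, on_edges U /\ forall z, outflow U z = a z - stat M z.
  by apply: flow_exists; rewrite sumrB !pmf_sum1 subrr.
have [U1 [eU1 oU1]] : exists U, on_edges U /\ forall z, outflow U z = stat M z - b z.
  by apply: flow_exists; rewrite sumrB !pmf_sum1 subrr.
pose mu t := mix_prob schedule.[t].
pose V t x y := 2 * (deriv schedule).[t] *
  ((1 - schedule.[t]) * U0 x y + schedule.[t] * U1 x y).
have VE x y : (fun t => V t x y) = horner (2%:P * (deriv schedule) *
    ((1 - schedule) * (U0 x y)%:P + schedule * (U1 x y)%:P)).
  by apply/funext => t; rewrite /V; move: schedule => s; rewrite !hornerE.
have oV t x : outflow (V t) x = - (deriv (mix_poly x)).[t].
  rewrite deriv_mix_poly.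
  rewrite (_ : outflow (V t) x = 2 * (deriv schedule).[t] *
      ((1 - schedule.[t]) * outflow U0 x + schedule.[t] * outflow U1 x)).
    by rewrite oU0 oU1; ring.
  by rewrite -!outflowZ -outflowD -outflowZ.
have in01 t : D t -> 0 <= t <= 1 by rewrite /= in_itv.
have cmu x : {within D, continuous (fun t : R => mu t x)}.
  apply: (subspace_eq_continuous _ (smooth_within (smooth_horner (mix_poly x)))).
  by move=> t; rewrite inE => /in01 t01; exact: mix_polyE.
have s0 : schedule.[0] = 0 by rewrite scheduleE; ring.
have s1 : schedule.[1] = 1 by rewrite scheduleE; ring.
have ce : continuity_eq a b mu V.
  split=> //.
  - move=> x y; rewrite (_ : (fun t => _) = EFin \o (fun t => V t x y))// VE.
    exact/within_continuous_integrable/smooth_within/smooth_horner.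
  - apply: fprob_ext => x; rewrite /mu s0 /= /clamp lexx ler01 /= /mix; ring.
  - apply: fprob_ext => x; rewrite /mu s1 /= /clamp lexx ler01 /= /mix; ring.
  move=> x phi tphi; have sphi := test_function_smooth tphi.
  have sp := smooth_horner (mix_poly x).
  have [p0 p1] := test_function_endpoints tphi.
  have := Rintegral_derive1 (smoothM sphi sp); rewrite /= p0 p1 !mul0r subr0.
  under eq_Rintegral do rewrite derive1M//.
  have i1 := within_continuous_integrable
    (within_continuousM (smooth_within (smooth_derive1 sphi)) (smooth_within sp)).
  have i2 := within_continuous_integrable
    (within_continuousM (smooth_within sphi) (smooth_within (smooth_derive1 sp))).
  rewrite Rintegral01D// => /eqP; rewrite addr_eq0 => /eqP e.
  transitivity (\int[lam]_(t in D) (derive1 phi t * (mix_poly x).[t])).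
    by apply: eq_Rintegral => t; rewrite inE => /in01 t01; rewrite mix_polyE.
  rewrite e -mulN1r -RintegralZl//; apply: eq_Rintegral => t _.
  by rewrite -[X in _ = _ * X]/(outflow (V t) x) oV derive1_horner mulN1r mulrN.
exists (mu, V); split=> //=.
pose C x y := 72 * (`|U0 x y| + `|U1 x y|) ^+ 2 / (stat M x * rate x y).
have C0 x y : 0 <= C x y.
  by rewrite divr_ge0// mulr_ge0 ?sqr_ge0 ?Defs.pmf_ge0 ?rate_ge0.
have key t x y : 0 <= t <= 1 -> (action_density L (mu t x * rate x y)
    (mu t y * rate y x) (V t x y) <= (C x y)%:E)%E.
  move=> t01; have /andP[c0 c1] := schedule01 t01.
  have ge0 (rho : fprob R M) u v : 0 <= rho u * rate u v.
    by apply: mulr_ge0; [exact: Defs.pmf_ge0|exact: rate_ge0].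
  have [xy|xy0] := eqVneq (rate x y) 0.
    by rewrite /V eU0// eU1// !mulr0 addr0 mulr0 action_density0// lee_fin.
  have xy : 0 < rate x y by rewrite lt_neqAle eq_sym xy0 rate_ge0.
  (* at the ends of the interval the speed, hence the flux, is 0 *)
  have [sp|sn] := ltP 0 (schedule.[t] * (1 - schedule.[t])); last first.
    have := deriv_schedule_le t01; move: sn; set S := _ * (1 - _) => sn h.
    have /eqP : (deriv schedule).[t] ^+ 2 = 0.
      by apply/eqP; rewrite eq_le sqr_ge0 andbT; lra.
    rewrite sqrf_eq0 => /eqP d0.
    by rewrite /V d0 mulr0 mul0r action_density0// lee_fin.
  set S := schedule.[t] * _ in sp.
  pose m := 2 * S * (stat M x * rate x y).
  have m0 : 0 < m.
    apply: mulr_gt0; first exact: mulr_gt0.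
    by apply: mulr_gt0 => //; exact: stat_gt0.
  have le_mix z : 2 * S * stat M z <= mu t z.
    have -> : mu t z = (1 - schedule.[t]) ^+ 2 * a z + 2 * S * stat M z +
        schedule.[t] ^+ 2 * b z.
      by rewrite /mu /= /clamp c0 c1 /= /mix /S; ring.
    have : 0 <= (1 - schedule.[t]) ^+ 2 * a z.
      by rewrite mulr_ge0 ?sqr_ge0 ?Defs.pmf_ge0.
    have : 0 <= schedule.[t] ^+ 2 * b z.
      by rewrite mulr_ge0 ?sqr_ge0 ?Defs.pmf_ge0.
    by lra.
  apply: (@le_trans _ _ ((V t x y ^+ 2 / m)%:E)).
    apply: action_density_le => //.
      by rewrite /m mulrA ler_wpM2r ?rate_ge0.
    by rewrite /m stat_reversible mulrA ler_wpM2r ?rate_ge0.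
  rewrite lee_fin /C ler_pdivrMr//.
  rewrite (_ : _ / _ * m = 144 * S * (`|U0 x y| + `|U1 x y|) ^+ 2); last first.
    have P0 : stat M x * rate x y != 0 by rewrite mulf_neq0// gt_eqF// stat_gt0.
    by rewrite /m; move: (stat M x * rate x y) P0 => P P0; field.
  have hW : `|(1 - schedule.[t]) * U0 x y + schedule.[t] * U1 x y| <=
      `|U0 x y| + `|U1 x y|.
    apply: (le_trans (ler_normD _ _)); rewrite !normrM.
    by rewrite lerD// ler_piMl// ger0_norm ?subr_ge0// lerBlDr lerDl.
  have hW2 : ((1 - schedule.[t]) * U0 x y + schedule.[t] * U1 x y) ^+ 2 <=
      (`|U0 x y| + `|U1 x y|) ^+ 2.
    rewrite -(real_normK (num_real ((1 - schedule.[t]) * U0 x y +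
      schedule.[t] * U1 x y))).
    by rewrite lerXn2r ?nnegrE// addr_ge0.
  rewrite /V !exprMn; apply: ler_pM; last exact: hW2.
    by apply: mulr_ge0; exact: sqr_ge0.
    exact: sqr_ge0.
  have := deriv_schedule_le t01; rewrite -/S.
  by move: ((deriv schedule).[t] ^+ 2) => d2; lra.
apply: (@le_lt_trans _ _
  (\int[lam]_(t in `[0%R, 1%R]) (2^-1 * \sum_x \sum_y C x y)%:E)%E).
  apply: ge0_le_integral => //.
  - by move=> t _; exact: action_ge0.
  - exact: measurable_action ce.
  move=> t /in01 t01; rewrite EFinM /action lee_wpmul2l ?lee_fin ?invr_ge0//.
  rewrite -sumEFin; apply: lee_sum => x _; rewrite -sumEFin; apply: lee_sum => y _.
  exact: key.
rewrite integral_cst//= lebesgue_measure_itv /= lte_fin ltr01 -EFinB subr0.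
by rewrite mule1 ltry.
Qed.

End finite_energy.
(** Clearing denominators, the last inequality and the two bounds give
    [K <= 4 t (1 - t) w delta + delta ^ 2]; as [delta <= 1] this is at most
    [delta (4 w + 1)], which is less than [K] for the given choice of [delta]. *)
Lemma detour_too_short (R : realFieldType) (t w K f1 f2 : R) :
  let delta := K / (K + 4 * w + 1) in
  0 < t -> t < 1 -> 0 <= w -> 0 < K ->
  f1 + K < (t * w + delta) ^+ 2 -> f2 + K < ((1 - t) * w + delta) ^+ 2 ->
  w ^+ 2 <= t^-1 * f1 + (1 - t)^-1 * f2 -> False.
Proof.
move=> delta t0 t1 w0 K0 l1 l2 h; have t1' : 0 < 1 - t by rewrite subr_gt0.
have den0 : 0 < K + 4 * w + 1 by lra.
have dE : delta * (K + 4 * w + 1) = K by rewrite /delta mulfVK// gt_eqF.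
have d0 : 0 < delta by rewrite divr_gt0.
have d1 : delta <= 1 by rewrite ler_pdivrMr// mul1r; lra.
move: dE d0 d1 l1 l2; move: delta => d dE d0 d1 l1 l2.
have tt0 : 0 < t * (1 - t) by rewrite mulr_gt0.
have : t * (1 - t) * w ^+ 2 <= (1 - t) * f1 + t * f2.
  rewrite (_ : (1 - t) * f1 + t * f2 = t * (1 - t) * (t^-1 * f1 + (1 - t)^-1 * f2)).
    by rewrite ler_pM2l.
  by field; rewrite !gt_eqF.
have : (1 - t) * (f1 + K) <= (1 - t) * (t * w + d) ^+ 2 by rewrite ler_pM2l// ltW.
have : t * (f2 + K) <= t * ((1 - t) * w + d) ^+ 2 by rewrite ler_pM2l// ltW.
have : 0 <= (1 - t * (1 - t)) * (w * d).
  by rewrite !mulr_ge0// ?(ltW d0)// subr_ge0; nra.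
have : 0 <= (1 - d) * d by rewrite mulr_ge0 ?subr_ge0// ltW.
have : 0 < d * K by rewrite mulr_gt0.
lra.
Qed.

(** * Geodesics avoid the collapsed set *)

Section distance.
Context {R : realType} (L : R * R -> R) (hL : admissible_mean L).
Context {M : markov_triple R}.
Implicit Types (a b : fprob R M) (mu : R -> fprob R M) (V : R -> M -> M -> R).

Lemma transport_dist_le a b mu V : continuity_eq a b mu V ->
  (transport_dist L a b <= sqrte (energy L mu V))%E.
Proof. by move=> ce; apply: ereal_inf_lbound; exists (mu, V). Qed.

Lemma transport_dist_ge0 a b : (0 <= transport_dist L a b)%E.
Proof. by apply: le_ereal_inf_tmp => _ [c _ <-]; exact: sqrte_ge0. Qed.

Lemma transport_dist_fin a b : transport_dist L a b \is a fin_num.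
Proof.
rewrite ge0_fin_numE ?transport_dist_ge0//.
have [c [ce fin]] := finite_energy hL a b.
apply: (le_lt_trans (transport_dist_le ce)).
rewrite -ge0_fin_numE ?sqrte_ge0// sqrte_fin_num ?energy_ge0// ge0_fin_numE//.
exact: energy_ge0.
Qed.

Lemma transport_dist_sqr_le a b mu V (w e : R) : continuity_eq a b mu V ->
  transport_dist L a b = w%:E -> energy L mu V = e%:E -> w ^+ 2 <= e.
Proof.
move=> ce dw Ee; have := transport_dist_le ce; rewrite dw Ee lee_fin => we.
have e0 : 0 <= e by rewrite -lee_fin -Ee energy_ge0.
have w0 : 0 <= w by rewrite -lee_fin -dw transport_dist_ge0.
by rewrite -(sqr_sqrtr e0) lerXn2r ?nnegrE.
Qed.

(** The approximation is on the level of square roots, which is why the energy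
    is compared with the square of [w + delta]. *)
Lemma transport_dist_approx a b (w delta : R) : transport_dist L a b = w%:E ->
  0 < delta -> exists c e, [/\ continuity_eq a b c.1 c.2,
    energy L c.1 c.2 = e%:E & e < (w + delta) ^+ 2].
Proof.
move=> dw d0; have w0 : 0 <= w by rewrite -lee_fin -dw transport_dist_ge0.
have : (transport_dist L a b < (w + delta)%:E)%E by rewrite dw lte_fin ltrDl.
move=> /ereal_inf_lt[_ [c ce <-]] lt.
have E0 : (0 <= energy L c.1 c.2)%E by exact: energy_ge0.
move: lt; rewrite -/(energy L c.1 c.2).
case Ee : (energy L c.1 c.2) E0 => [e| |] // e0.
rewrite /= lte_fin => lt; exists c, e; split=> //.
by rewrite -(sqr_sqrtr e0) ltrXn2r ?nnegrE ?sqrtr_ge0// addr_ge0// ltW.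
Qed.

Variables (B : {pred M}) (o : M).
Hypothesis oB : o \notin B.
Hypothesis cut : forall x y : M, x \notin B -> x != o -> y \in B -> rate x y = 0.

Lemma push_collapse_id a : (forall x, x \in B -> a x = 0) ->
  push_prob (collapse B o) a = a.
Proof.
move=> aB; apply: fprob_ext => x /=.
rewrite big_mkcond [RHS](_ : _ = \sum_y if y == x then a y else 0); last first.
  by rewrite -big_mkcond big_pred1_eq.
apply: eq_bigr => y _; rewrite /collapse; have [yB|//] := boolP (y \in B).
by rewrite aB// !if_same.
Qed.

(** The collapsed halves still fit together at the time [t], as both pass
    through the collapse of [mu t], while the collapse leaves the end points
    alone. *)
Lemma geodesic_avoids mu : geodesic L mu ->
  (forall x, x \in B -> mu 0 x = 0) -> (forall x, x \in B -> mu 1 x = 0) ->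
  forall t x, t \in `[0, 1] -> x \in B -> mu t x = 0.
Proof.
move=> geo m0 m1 t x t01 xB.
have [-> |tn0] := eqVneq t 0; first exact: m0.
have [-> |tn1] := eqVneq t 1; first exact: m1.
have tau01 : 0 < t < 1.
  by move: t01; rewrite in_itv /= !lt_neqAle tn1 (eq_sym 0) tn0.
have /andP[t0 t1] := tau01; have t1' : 0 < 1 - t by rewrite subr_gt0.
pose m := \sum_(y in B) mu t y.
have mx : mu t x <= m.
  by rewrite /m (bigD1 x)//= lerDl sumr_ge0// => *; exact: Defs.pmf_ge0.
apply/eqP; rewrite eq_le Defs.pmf_ge0 andbT (le_trans mx)// leNgt.
apply/negP => mgt0.
pose K := @leak_constant R M * m ^+ 2.
have K0 : 0 < K by rewrite mulr_gt0 ?leak_constant_gt0// exprn_gt0.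
have i0 : (0 : R) \in `[0, 1] by rewrite in_itv /= lexx ler01.
have i1 : (1 : R) \in `[0, 1] by rewrite in_itv /= lexx ler01.
have [w dw] : exists w, transport_dist L (mu 0) (mu 1) = w%:E.
  by exists (fine (transport_dist L (mu 0) (mu 1))); rewrite fineK ?transport_dist_fin.
have w0 : 0 <= w by rewrite -lee_fin -dw transport_dist_ge0.
have d1 : transport_dist L (mu 0) (mu t) = (t * w)%:E.
  by rewrite geo// dw subr0 ger0_norm ?ltW.
have d2 : transport_dist L (mu t) (mu 1) = ((1 - t) * w)%:E.
  by rewrite geo// dw ger0_norm ?ltW.
pose delta := K / (K + 4 * w + 1).
have den0 : 0 < K + 4 * w + 1 by lra.
have delta0 : 0 < delta by rewrite divr_gt0.
have [c1 [e1 [ce1 E1 l1]]] := transport_dist_approx d1 delta0.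
have [c2 [e2 [ce2 E2 l2]]] := transport_dist_approx d2 delta0.
have := energy_collapse hL oB cut ce1; have := energy_collapse hL oB cut ce2.
have S0 : \sum_(y in B) mu 0 y = 0 by apply: big1 => y yB; exact: m0.
have S1 : \sum_(y in B) mu 1 y = 0 by apply: big1 => y yB; exact: m1.
rewrite E1 E2 S0 S1 -/m subr0 sub0r sqrrN -/K.
have := continuity_eq_push (collapse B o) ce1.
have := continuity_eq_push (collapse B o) ce2.
rewrite (push_collapse_id m0) (push_collapse_id m1).
set mu1 := (fun _ => push_prob _ _); set V1 := (fun _ => push_flux _ _).
set mu2 := (fun _ => push_prob _ _); set V2 := (fun _ => push_flux _ _).
move=> pe2 pe1.
have := energy_ge0 hL mu2 V2; have := energy_ge0 hL mu1 V1.
have EC := energy_concat hL tau01 pe1 pe2.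
have CC := continuity_eq_concat tau01 pe1 pe2.
case F1 : (energy L mu1 V1) EC => [f1| |] //.
case F2 : (energy L mu2 V2) => [f2| |] //.
rewrite -!EFinM -!EFinD => EC _ _; rewrite !lee_fin => h2 h1.
have h := transport_dist_sqr_le CC dw EC.
apply: (detour_too_short t0 t1 w0 K0 _ _ h).
- exact: le_lt_trans h1 l1.
- exact: le_lt_trans h2 l2.
Qed.

End distance.

Unset Implicit Arguments.

Theorem theorem5p5 (R : realType) (M1 M2 : markov_triple R) (x1 : M1) (x2 : M2)
    (L : R * R -> R) (hL : admissible_mean L)
    (mu : R -> fprob R (glued_triple x1 x2)) (hmu : geodesic L mu)
    (h0 : {subset support (mu 0) <= codom (glue_in1 x1 x2)})
    (h1 : {subset support (mu 1) <= codom (glue_in1 x1 x2)}) :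
  forall t : R, t \in `[0, 1] ->
    {subset support (mu t) <= codom (glue_in1 x1 x2)}.
Proof.
pose B : {pred glued_triple x1 x2} :=
  [pred z : glue_state x1 x2 | if z is Some (inr _) then true else false].
have codomE z : (z \in codom (glue_in1 x1 x2)) = (z \notin B).
  apply/codomP/idP => [[u ->]|]; first by rewrite /glue_in1; case: insubP.
  case: z => [[u|v]|] // _; first by exists (val u); rewrite /glue_in1 valK.
  by exists x1; rewrite glue_in1_base.
have offB nu : {subset support nu <= codom (glue_in1 x1 x2)} ->
    forall z, z \in B -> nu z = 0 :> R.
  move=> sub z zB; apply/eqP/negPn/negP => /sub; rewrite codomE; by rewrite zB.
have noneB : (None : glued_triple x1 x2) \notin B by [].
have cut (x y : glued_triple x1 x2) :
    x \notin B -> x != None -> y \in B -> rate x y = 0.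
  by case: x => [[u|v]|] //; case: y => [[u'|v']|].
move=> t t01 z zs; rewrite codomE; apply/negP => zB.
have := geodesic_avoids hL noneB cut hmu (offB _ h0) (offB _ h1) t01 zB.
by move/eqP; apply/negP.
Qed.
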